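(* Let $n\ge 2$ be a positive integer, let $\Bbbk$ be a field containing a primitive $n$-th root of unity $\omega$, and let $H_{n^2}$ be the Taft Hopf algebra. The left coideal subalgebras of $H_{n^2}$ fall into two classes: (1) semisimple ones, each isomorphic to $\Bbbk G'$ through the composition $\mathcal{N}\hookrightarrow H_{n^2}\to\Bbbk G$ for some subgroup $G'\le G$; these are in bijection with right group-like projections of $H_{n^2}$ (via $P\mapsto\mathcal{N}_P$); (2) non-semisimple ones, each equal to one of the coideal subalgebras $\mathcal{N}_{d,x}$ for divisors $d\mid n$.
   Context: The Taft Hopf algebra $H_{n^2}$ is the algebra $\Bbbk[x]/(x^n)\rtimes\Bbbk[G]$, where $G=\mathbb{Z}/n\mathbb{Z}$ is generated by $g$ (so $g^n=1$, $x^n=0$) and $gxg^{-1}=\omega x$; its coalgebra structure is $\Delta(g)=g\otimes g$, $\Delta(x)=x\otimes 1+g\otimes x$. It is $n^2$-dimensional with basis $x^ig^j$, $0\le i,j\le n-1$. The map $H_{n^2}\to\Bbbk G$ is the Hopf algebra surjection with $x\mapsto 0$, $g\mapsto g$. A left coideal subalgebra of a Hopf algebra $\mathcal{A}$ is a unital subalgebra $\mathcal{N}$ with $\Delta(\mathcal{N})\subset\mathcal{A}\otimes\mathcal{N}$. For a divisor $d\mid n$, $\mathcal{N}_{d,x}$ is the (unital) subalgebra of $H_{n^2}$ generated by $g^d$ and $x$. A right group-like projection is a non-zero idempotent $P$ with $\Delta(P)(1\otimes P)=P\otimes P=(1\otimes P)\Delta(P)$, and $\mathcal{N}_P=\{y\in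 H_{n^2}:\Delta(y)(1\otimes P)=(1\otimes P)\Delta(y)=y\otimes P\}$. *)

(* Defs.v *)
From HB Require Import structures.
From mathcomp Require Import all_boot all_order all_algebra all_fingroup all_field.

Set Implicit Arguments.
Unset Strict Implicit.
Unset Printing Implicit Defensive.

Import GRing.Theory.
Local Open Scope ring_scope.

(* A unital associative algebra on a finite basis B: e_a * e_b = sum_c C a b c *: e_c
   and 1 = sum_b U b *: e_b. *)
Record algData (K : fieldType) := AlgData {
  abasis :> finType;
  amulC : abasis -> abasis -> abasis -> K;
  aunitC : abasis -> K;
  amulCA : forall a b c d : abasis,
    \sum_e amulC a b e * amulC e c d = \sum_e amulC b c e * amulC a e d;
  amulC1l : forall b d : abasis, \sum_e aunitC e * amulC e b d = (b == d)%:R;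
  amulC1r : forall b d : abasis, \sum_e aunitC e * amulC b e d = (b == d)%:R;
  aunitC_neq0 : exists b, aunitC b != 0 }.

Definition alg (K : fieldType) (D : algData K) := {ffun D -> K^o}.

HB.instance Definition _ (K : fieldType) (D : algData K) :=
  Vector.on (alg D).

Section Alg.
Variables (K : fieldType) (D : algData K).
Implicit Types (u v w : alg D) (b : D).

Definition alg_mul u v : alg D :=
  [ffun d => \sum_a \sum_b u a * v b * amulC a b d].
Definition alg_one : alg D := [ffun b => aunitC b].
Definition gen b : alg D := [ffun d => (b == d)%:R].

Lemma sum_delta (F : D -> K) d : \sum_b F b * (b == d)%:R = F d.
Proof.
rewrite (bigD1 d) //= eqxx mulr1 big1 ?addr0 // => b /negPf ->.
by rewrite mulr0.
Qed.

Lemma sum_delta_sym (F : D -> K) d : \sum_b (d == b)%:R * F b = F d.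
Proof.
rewrite -[RHS]sum_delta; apply: eq_bigr => b _.
by rewrite mulrC eq_sym.
Qed.

Lemma gen_sum u : u = \sum_b u b *: gen b.
Proof.
apply/ffunP => d; rewrite sum_ffunE -[LHS]sum_delta.
by apply: eq_bigr => b _; rewrite !ffunE.
Qed.

Fact alg_mulA : associative alg_mul.
Proof.
move=> u v w; apply/ffunP => d; rewrite !ffunE.
transitivity (\sum_a \sum_b \sum_c u a * v b * w c *
    \sum_e amulC b c e * amulC a e d).
  apply: eq_bigr => a _; rewrite (eq_bigr (fun e => \sum_b \sum_c
      u a * v b * w c * (amulC b c e * amulC a e d))); last first.
    move=> e _; rewrite ffunE mulr_sumr mulr_suml; apply: eq_bigr => b _.
    rewrite mulr_sumr mulr_suml; apply: eq_bigr => c _.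
    by rewrite !mulrA.
  rewrite exchange_big /=; apply: eq_bigr => b _.
  rewrite exchange_big /=; apply: eq_bigr => c _.
  by rewrite mulr_sumr.
transitivity (\sum_e \sum_c \sum_a \sum_b
    u a * v b * w c * (amulC a b e * amulC e c d)); last first.
  apply: eq_bigr => e _; apply: eq_bigr => c _.
  rewrite ffunE !mulr_suml; apply: eq_bigr => a _.
  rewrite !mulr_suml; apply: eq_bigr => b _.
  by rewrite !mulrA -!(mulrAC _ (w c)).
rewrite exchange_big /= [RHS]exchange_big /=.
rewrite exchange_big /=; under [RHS]eq_bigr => c _ do rewrite exchange_big /=.
rewrite [RHS]exchange_big /=; apply: eq_bigr => a _.
under [RHS]eq_bigr => c _ do rewrite exchange_big /=.
rewrite [RHS]exchange_big /=; apply: eq_bigr => b _; apply: eq_bigr => c _.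
by rewrite -mulr_sumr -(amulCA a b c d).
Qed.

Fact alg_mul1l : left_id alg_one alg_mul.
Proof.
move=> u; apply/ffunP => d; rewrite ffunE exchange_big -[RHS]sum_delta /=.
apply: eq_bigr => b _; rewrite -amulC1l mulr_sumr.
by apply: eq_bigr => a _; rewrite ffunE mulrA [_ * u b]mulrC.
Qed.

Fact alg_mul1r : right_id alg_one alg_mul.
Proof.
move=> u; apply/ffunP => d; rewrite ffunE -[RHS]sum_delta /=.
apply: eq_bigr => b _; rewrite -amulC1r mulr_sumr.
by apply: eq_bigr => a _; rewrite ffunE mulrA.
Qed.

Fact alg_mulDl : left_distributive alg_mul +%R.
Proof.
move=> u v w; apply/ffunP => d; rewrite !ffunE -big_split.
apply: eq_bigr => a _; rewrite -big_split; apply: eq_bigr => b _.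
by rewrite ffunE !mulrDl.
Qed.

Fact alg_mulDr : right_distributive alg_mul +%R.
Proof.
move=> u v w; apply/ffunP => d; rewrite !ffunE -big_split.
apply: eq_bigr => a _; rewrite -big_split; apply: eq_bigr => b _.
by rewrite ffunE mulrDr !mulrDl.
Qed.

Fact alg_one_neq0 : alg_one != 0.
Proof.
have [b] := aunitC_neq0 D; apply: contraNneq => /ffunP /(_ b).
by rewrite !ffunE => ->.
Qed.

HB.instance Definition _ := GRing.Zmodule_isNzRing.Build (alg D)
  alg_mulA alg_mul1l alg_mul1r alg_mulDl alg_mulDr alg_one_neq0.

Fact alg_scaleAl (k : K) u v : k *: (u * v) = (k *: u) * v.
Proof.
apply/ffunP => d; rewrite !ffunE scaler_sumr; apply: eq_bigr => a _.
rewrite scaler_sumr; apply: eq_bigr => b _.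
by rewrite ffunE /= /GRing.scale /= !mulrA.
Qed.
HB.instance Definition _ := GRing.Lmodule_isLalgebra.Build K (alg D) alg_scaleAl.

Fact alg_scaleAr (k : K) u v : k *: (u * v) = u * (k *: v).
Proof.
apply/ffunP => d; rewrite !ffunE scaler_sumr; apply: eq_bigr => a _.
rewrite scaler_sumr; apply: eq_bigr => b _.
by rewrite ffunE /= /GRing.scale /= !mulrA (mulrC k).
Qed.
HB.instance Definition _ := GRing.Lalgebra_isAlgebra.Build K (alg D) alg_scaleAr.
HB.instance Definition _ := Algebra_isFalgebra.Build K (alg D).

Lemma gen_mul a b : gen a * gen b = [ffun d => amulC a b d].
Proof.
apply/ffunP => d; rewrite !ffunE.
rewrite -[RHS](sum_delta_sym (fun a => amulC a b d)); apply: eq_bigr => a' _.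
rewrite -[X in _ * X](sum_delta_sym (fun b => amulC a' b d)) mulr_sumr.
by apply: eq_bigr => b' _; rewrite !ffunE mulrA.
Qed.

End Alg.

Section LinExt.
Variables (K : fieldType) (D : algData K) (V : vectType K) (f : D -> V).

Definition linext_fun (u : alg D) : V := \sum_b u b *: f b.

Fact linext_fun_linear : linear linext_fun.
Proof.
move=> k u v; rewrite /linext_fun scaler_sumr -big_split /=.
by apply: eq_bigr => b _; rewrite !ffunE scalerDl scalerA.
Qed.
HB.instance Definition _ := GRing.isLinear.Build K (alg D) V _ linext_fun
  linext_fun_linear.

(* The linear map with e_b |-> f b. *)
Definition linext : 'Hom(alg D, V) := linfun linext_fun.

Lemma linextE u : linext u = \sum_b u b *: f b.
Proof. by rewrite lfunE. Qed.

Lemma linext_gen b : linext (gen b) = f b.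
Proof.
rewrite linextE (bigD1 b) //= ffunE eqxx scale1r big1 ?addr0 // => d.
by rewrite eq_sym ffunE => /negPf ->; rewrite scale0r.
Qed.

End LinExt.

Section Tensor.
Variables (K : fieldType) (D E : algData K).

Definition tens_mulC (a b c : D * E) : K :=
  amulC a.1 b.1 c.1 * amulC a.2 b.2 c.2.
Definition tens_unitC (b : D * E) : K := aunitC b.1 * aunitC b.2.

Fact tens_sum (F : D -> K) (G : E -> K) :
  \sum_(e : D * E) F e.1 * G e.2 = (\sum_a F a) * (\sum_b G b).
Proof. by rewrite -(pair_bigA _ (fun a b => F a * G b)) big_distrlr. Qed.

Fact tens_mulCA (a b c d : D * E) :
  \sum_e tens_mulC a b e * tens_mulC e c d =
  \sum_e tens_mulC b c e * tens_mulC a e d.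
Proof.
under eq_bigr => e _ do rewrite /tens_mulC mulrACA.
under [RHS]eq_bigr => e _ do rewrite /tens_mulC mulrACA.
rewrite (tens_sum (fun e => amulC a.1 b.1 e * amulC e c.1 d.1)
  (fun e => amulC a.2 b.2 e * amulC e c.2 d.2)) !amulCA.
by rewrite -(tens_sum (fun e => amulC b.1 c.1 e * amulC a.1 e d.1)
  (fun e => amulC b.2 c.2 e * amulC a.2 e d.2)).
Qed.

Fact tens_mulC1l (b d : D * E) :
  \sum_e tens_unitC e * tens_mulC e b d = (b == d)%:R.
Proof.
under eq_bigr => e _ do rewrite /tens_mulC mulrACA.
rewrite (tens_sum (fun e => aunitC e * amulC e b.1 d.1)
  (fun e => aunitC e * amulC e b.2 d.2)) !amulC1l -natrM mulnb.
by case: b d => b1 b2 [d1 d2].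
Qed.

Fact tens_mulC1r (b d : D * E) :
  \sum_e tens_unitC e * tens_mulC b e d = (b == d)%:R.
Proof.
under eq_bigr => e _ do rewrite /tens_mulC mulrACA.
rewrite (tens_sum (fun e => aunitC e * amulC b.1 e d.1)
  (fun e => aunitC e * amulC b.2 e d.2)) !amulC1r -natrM mulnb.
by case: b d => b1 b2 [d1 d2].
Qed.

Fact tens_unitC_neq0 : exists b, tens_unitC b != 0.
Proof.
have [a ha] := aunitC_neq0 D; have [b hb] := aunitC_neq0 E.
by exists (a, b); rewrite mulf_neq0.
Qed.

Definition tens_data := @AlgData K (D * E)%type _ _
  tens_mulCA tens_mulC1l tens_mulC1r tens_unitC_neq0.

(* (alg D) (x) (alg E), with basis the e_a (x) e_b. *)
Definition tensor := alg tens_data.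
HB.instance Definition _ := Falgebra.on tensor.

Definition tens (u : alg D) (v : alg E) : tensor :=
  [ffun p : tens_data => u p.1 * v p.2].

Lemma tensM u u' v v' : tens u v * tens u' v' = tens (u * u') (v * v').
Proof.
apply/ffunP => d; rewrite !ffunE.
rewrite -(tens_sum (fun a => \sum_b u a * u' b * amulC a b d.1)
  (fun a => \sum_b v a * v' b * amulC a b d.2)); apply: eq_bigr => a _.
rewrite -(tens_sum (fun b => u a.1 * u' b * amulC a.1 b d.1)
  (fun b => v a.2 * v' b * amulC a.2 b d.2)); apply: eq_bigr => b _.
rewrite !ffunE [amulC a b d]/(tens_mulC a b d) (mulrACA (u a.1)).
exact: mulrACA.
Qed.

Lemma tens11 : tens 1 1 = 1.
Proof. by apply/ffunP => b; rewrite !ffunE. Qed.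

Fact tens_linearr u : linear (tens u).
Proof.
move=> k v v'; apply/ffunP => b; rewrite !ffunE mulrDr; congr (_ + _).
by rewrite /GRing.scale /= !mulrA (mulrC k).
Qed.
HB.instance Definition _ u := GRing.isLinear.Build K (alg E) tensor _ (tens u)
  (@tens_linearr u).

Definition tensr v := tens^~ v.

Fact tensr_linear v : linear (tensr v).
Proof.
move=> k u u'; apply/ffunP => b; rewrite !ffunE mulrDl; congr (_ + _).
by rewrite /GRing.scale /= !mulrA.
Qed.
HB.instance Definition _ v := GRing.isLinear.Build K (alg D) tensor _ (tensr v)
  (@tensr_linear v).

Lemma tensX u v i : tens u v ^+ i = tens (u ^+ i) (v ^+ i).
Proof. by elim: i => [|i IHi]; rewrite ?tens11 // !exprS IHi tensM. Qed.

Lemma tensZl k u v : tens (k *: u) v = k *: tens u v.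
Proof. by rewrite -![tens _ v]/(tensr v _) linearZ. Qed.

Definition tensv (U : {vspace alg D}) (V : {vspace alg E}) : {vspace tensor} :=
  <<[seq tens u v | u <- vbasis U, v <- vbasis V]>>%VS.

Lemma memv_tens (U : {vspace alg D}) (V : {vspace alg E}) u v :
  u \in U -> v \in V -> tens u v \in tensv U V.
Proof.
move=> Uu Vv; rewrite (coord_vbasis Uu) (coord_vbasis Vv).
rewrite -[tens _ _]/(tensr _ _) linear_sum memv_suml // => i _.
rewrite linearZ memvZ //= /tensr linear_sum memv_suml // => j _.
by rewrite linearZ memvZ // memv_span // allpairs_f // mem_nth // size_tuple.
Qed.

End Tensor.

Section QBinomial.
Variables (K : fieldType) (w : K).

(* The coefficient of A^i B^j in (A + B)^(i + j) when B A = w A B. *)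
Fixpoint qbinom (i : nat) : nat -> K :=
  if i is i'.+1 then
    fix qbinom_i (j : nat) : K :=
      if j is j'.+1 then qbinom i' j + w ^+ i * qbinom_i j' else 1
  else fun=> 1.

Lemma qbinomSS i j :
  qbinom i.+1 j.+1 = qbinom i j.+1 + w ^+ i.+1 * qbinom i.+1 j.
Proof. by []. Qed.

Arguments qbinom : simpl never.

Lemma qbinom0i j : qbinom 0 j = 1. Proof. by []. Qed.

Lemma qbinomi0 i : qbinom i 0 = 1. Proof. by case: i. Qed.

Lemma qbinomSS' i j :
  qbinom i.+1 j.+1 = w ^+ j.+1 * qbinom i j.+1 + qbinom i.+1 j.
Proof.
elim: i j => [|i IHi]; elim=> [|j IHj].
- by rewrite qbinomSS !qbinom0i qbinomi0 !mulr1 addrC.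
- rewrite qbinomSS {1}IHj [in RHS]qbinomSS expr1 !qbinom0i.
  by rewrite !mulr1 mulrDr -exprS addrCA.
- rewrite qbinomSS {1}IHi [X in _ = _ * X + _]qbinomSS !qbinomi0 !mulr1 mulrDr.
  by rewrite -exprD addrAC.
rewrite qbinomSS {1}IHi {1}IHj [X in _ = _ * X + _]qbinomSS [X in _ = _ + X]qbinomSS.
move: (qbinom i j.+2) (qbinom i.+1 j.+1) (qbinom i.+2 j) => a b c.
have -> : w ^+ i.+2 * (w ^+ j.+1 * b + c) = w ^+ j.+2 * (w ^+ i.+1 * b) + w ^+ i.+2 * c.
  by rewrite mulrDr !mulrA -!exprD addSnnS addnC.
by rewrite mulrDr addrACA.
Qed.

Lemma qbinom_shift i j :
  qbinom i.+1 j * (1 - w ^+ i.+1) = qbinom i j.+1 * (1 - w ^+ j.+1).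
Proof.
have := etrans (esym (qbinomSS i j)) (qbinomSS' i j).
move: (qbinom i j.+1) (qbinom i.+1 j) => a c e; rewrite !mulrBr !mulr1.
by apply/eqP; rewrite subr_eq addrAC eq_sym subr_eq ![_ * w ^+ _]mulrC e addrC.
Qed.

Lemma qbinom_prim n i j : n.-primitive_root w ->
  (i + j = n)%N -> (0 < i)%N -> (0 < j)%N -> qbinom i j = 0.
Proof.
move=> hw; case: i => // i; elim: i j => [|i IHi] j ij _ j0.
  have /eqP := qbinom_shift 0 j.
  rewrite -[j.+1]add1n ij (prim_expr_order hw) subrr mulr0 mulf_eq0 subr_eq0.
  case/orP=> [/eqP // |]; rewrite -(expr0 w) (eq_prim_root_expr hw).
  by rewrite mod0n modn_small // -ij add1n ltnS.
have /eqP := qbinom_shift i.+1 j.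
rewrite IHi ?addnS // mul0r mulf_eq0 subr_eq0.
case/orP=> [/eqP // |]; rewrite -(expr0 w) (eq_prim_root_expr hw).
by rewrite mod0n modn_small // -ij -[X in (X < _)%N]addn0 ltn_add2l.
Qed.

Lemma qbinomial (A : falgType K) (X Y : A) m : Y * X = w *: (X * Y) ->
  (X + Y) ^+ m = \sum_(i < m.+1) qbinom i (m - i) *: (X ^+ i * Y ^+ (m - i)).
Proof.
move=> YX; have YXi i : Y * X ^+ i = w ^+ i *: (X ^+ i * Y).
  elim: i => [|i IHi]; first by rewrite mul1r mulr1 scale1r.
  by rewrite exprSr mulrA IHi -scalerAl -[in LHS]mulrA YX -scalerAr scalerA mulrA -!exprSr.
elim: m => [|m IHm]; first by rewrite big_ord1 /= scale1r mulr1.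
rewrite exprS IHm mulrDl !mulr_sumr.
have eX (i : 'I_m.+1) : X * (qbinom i (m - i) *: (X ^+ i * Y ^+ (m - i))) =
    qbinom i (m - i) *: (X ^+ i.+1 * Y ^+ (m - i)).
  by rewrite -scalerAr mulrA -exprS.
have eY (i : 'I_m.+1) : Y * (qbinom i (m - i) *: (X ^+ i * Y ^+ (m - i))) =
    (w ^+ i * qbinom i (m - i)) *: (X ^+ i * Y ^+ (m.+1 - i)).
  rewrite -scalerAr mulrA YXi -scalerAl scalerA mulrC -mulrA -exprS subSn //.
  by rewrite -ltnS.
rewrite (eq_bigr _ (fun i _ => eX i)) (eq_bigr _ (fun i _ => eY i)).
rewrite big_ord_recr [X in _ + X]big_ord_recl [RHS]big_ord_recl [X in _ = _ + X]big_ord_recr /=.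
rewrite !subn0 !subnn !qbinomi0 !qbinom0i !mul1r /bump leq0n add1n.
rewrite [LHS]addrC -!addrA; congr (_ + _).
rewrite addrA -big_split /=; congr (_ + _); apply: eq_bigr => i _.
rewrite !add1n subSS -scalerDl -(subnSK (ltn_ord i)) qbinomSS.
by rewrite addrC.
Qed.

Lemma qbinomial_prim (A : falgType K) (X Y : A) n :
  n.-primitive_root w -> Y * X = w *: (X * Y) -> (X + Y) ^+ n = X ^+ n + Y ^+ n.
Proof.
move=> hw YX; rewrite (qbinomial _ YX).
case: n hw => [|n] hw; first by have := prim_order_gt0 hw.
rewrite big_ord_recl big_ord_recr /= subn0 subnn !qbinomi0 !scale1r mul1r mulr1.
rewrite big1 ?add0r 1?addrC // => i _; rewrite /bump /= add1n.
have lt_in := ltn_ord i; rewrite (qbinom_prim hw) ?scale0r //.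
  by rewrite subnKC // ltnS ltnW.
by rewrite subn_gt0 ltnS.
Qed.

End QBinomial.

Section GroupAlgebra.
Variables (K : fieldType) (gT : finGroupType).
Implicit Types a b c d : gT.

Definition grp_mulC a b c : K := ((a * b)%g == c)%:R.
Definition grp_unitC b : K := (b == 1%g)%:R.

Fact grp_sum (F : gT -> K) b : \sum_e (b == e)%:R * F e = F b.
Proof.
rewrite (bigD1 b) //= eqxx mul1r big1 ?addr0 // => e.
by rewrite eq_sym => /negPf ->; rewrite mul0r.
Qed.

Fact grp_mulCA a b c d :
  \sum_e grp_mulC a b e * grp_mulC e c d = \sum_e grp_mulC b c e * grp_mulC a e d.
Proof. by rewrite !grp_sum /grp_mulC mulgA. Qed.

Fact grp_mulC1l b d : \sum_e grp_unitC e * grp_mulC e b d = (b == d)%:R.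
Proof.
under eq_bigr => e _ do rewrite /grp_unitC eq_sym.
by rewrite grp_sum /grp_mulC mul1g.
Qed.

Fact grp_mulC1r b d : \sum_e grp_unitC e * grp_mulC b e d = (b == d)%:R.
Proof.
under eq_bigr => e _ do rewrite /grp_unitC eq_sym.
by rewrite grp_sum /grp_mulC mulg1.
Qed.

Fact grp_unitC_neq0 : exists b, grp_unitC b != 0.
Proof. by exists 1%g; rewrite /grp_unitC eqxx oner_neq0. Qed.

Definition grp_data := @AlgData K gT _ _
  grp_mulCA grp_mulC1l grp_mulC1r grp_unitC_neq0.

Definition grpalg := alg grp_data.
HB.instance Definition _ := Falgebra.on grpalg.

Definition grpalg_of (h : gT) : grpalg := gen (h : grp_data).

Lemma grpalg_of1 : grpalg_of 1%g = 1.
Proof. by apply/ffunP => b; rewrite !ffunE /= /grp_unitC eq_sym. Qed.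

Lemma grpalg_ofM a b : grpalg_of a * grpalg_of b = grpalg_of (a * b)%g.
Proof. by rewrite gen_mul; apply/ffunP => c; rewrite !ffunE. Qed.

Definition subgrpalg (A : {set gT}) : {vspace grpalg} :=
  <<[seq grpalg_of h | h <- enum A]>>%VS.

End GroupAlgebra.

Section Taft.
Variables (K : fieldType) (n : nat) (w : K) (hw : n.-primitive_root w).

(* The basis element x^i g^j is indexed by (i, j) : 'I_n * 'Z_n. *)
Definition taft_basis : finType := ('I_n * 'Z_n)%type.
Implicit Types a b c d : taft_basis.

Definition taft_mulC a b c : K :=
  (((a.1 + b.1)%N == c.1) && (a.2 + b.2 == c.2))%:R * w ^+ (a.2 * b.1)%N.
Definition taft_unitC b : K := ((b.1 == 0 :> nat) && (b.2 == 0))%:R.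

Lemma taft_sum (F : taft_basis -> K) (i : nat) (j : 'Z_n) :
  \sum_(c : taft_basis) ((i == c.1 :> nat) && (j == c.2))%:R * F c =
  oapp (fun i' : 'I_n => F (i', j)) 0 (insub i).
Proof.
case: insubP => [i' _ <- | /negP ni] /=.
  rewrite (bigD1 (i', j)) //= !eqxx mul1r big1 ?addr0 // => -[c1 c2] neq_c.
  rewrite /= (_ : _ && _ = false) ?mul0r //; apply: contraNF neq_c.
  by case/andP=> /eqP/val_inj <- /eqP <-.
apply: big1 => c _; case: eqP => [ic | _]; last by rewrite mul0r.
by case: ni; rewrite ic.
Qed.

Lemma expr_Zp (m : nat) (j l : 'Z_n) : w ^+ ((j + l)%R * m)%N = w ^+ (j * m + l * m)%N.
Proof.
have w1 : w ^+ (Zp_trunc n).+2 = 1.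
  have [n1 | n1] := ltnP 1 n; first by rewrite Zp_cast ?prim_expr_order.
  have n1' : n = 1%N by apply/eqP; rewrite eqn_leq n1 (prim_order_gt0 hw).
  suff -> : w = 1 by rewrite expr1n.
  by rewrite -[w]expr1 -n1' prim_expr_order.
by rewrite -mulnDl !exprM /= expr_mod.
Qed.

Fact taft_mulCA a b c d :
  \sum_e taft_mulC a b e * taft_mulC e c d =
  \sum_e taft_mulC b c e * taft_mulC a e d.
Proof.
rewrite /taft_mulC.
under eq_bigr => e _ do rewrite -mulrA.
under [RHS]eq_bigr => e _ do rewrite -mulrA.
rewrite !taft_sum.
have expw : w ^+ (a.2 * b.1)%N * w ^+ ((a.2 + b.2)%R * c.1)%N =
  w ^+ (b.2 * c.1)%N * w ^+ (a.2 * (b.1 + c.1))%N.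
  by rewrite expr_Zp -!exprD mulnDr; congr (_ ^+ _); rewrite !addnA addnC addnA.
case: insubP => [i _ /= ei | /negP ni] /=; case: insubP => [j _ /= ej | /negP nj] //=.
- rewrite ei ej addnA addrA.
  rewrite mulrCA expw [in RHS]mulrCA; congr (_ * _).
- rewrite ei; case: eqP => [eid | _]; last by rewrite mul0r mulr0.
  by case: nj; rewrite (leq_ltn_trans _ (ltn_ord d.1)) // -eid -addnA leq_addl.
- rewrite ej; case: eqP => [eid | _]; last by rewrite mul0r mulr0.
  by case: ni; rewrite (leq_ltn_trans _ (ltn_ord d.1)) // -eid addnA leq_addr.
Qed.

Fact taft_mulC1l b d : \sum_e taft_unitC e * taft_mulC e b d = (b == d)%:R.
Proof.
under eq_bigr => e _ do rewrite /taft_unitC eq_sym [_ == 0]eq_sym.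
rewrite taft_sum; case: insubP => [i _ /= ei | /negP []]; last exact: (prim_order_gt0 hw).
by rewrite /taft_mulC /= ei add0n add0r mul0n mulr1.
Qed.

Fact taft_mulC1r b d : \sum_e taft_unitC e * taft_mulC b e d = (b == d)%:R.
Proof.
under eq_bigr => e _ do rewrite /taft_unitC eq_sym [_ == 0]eq_sym.
rewrite taft_sum; case: insubP => [i _ /= ei | /negP []]; last exact: (prim_order_gt0 hw).
by rewrite /taft_mulC /= ei addn0 addr0 muln0 mulr1.
Qed.

Fact taft_unitC_neq0 : exists b, taft_unitC b != 0.
Proof.
exists (Ordinal (prim_order_gt0 hw), 0).
by rewrite /taft_unitC /= oner_neq0.
Qed.

Definition taft_data := @AlgData K taft_basis _ _
  taft_mulCA taft_mulC1l taft_mulC1r taft_unitC_neq0.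

Definition taft := alg taft_data.
HB.instance Definition _ := Falgebra.on taft.

Definition taft_mono (i : nat) (j : 'Z_n) : taft :=
  [ffun b : taft_data => ((i == b.1 :> nat) && (j == b.2))%:R].

Definition taft_x : taft := taft_mono 1 0.
Definition taft_g : taft := taft_mono 0 1.

Lemma taft_mono_gen (b : taft_data) : taft_mono b.1 b.2 = gen b.
Proof. by apply/ffunP => c; rewrite !ffunE; case: b c => b1 b2 [c1 c2]. Qed.

Lemma taft_mono_ge i j : (n <= i)%N -> taft_mono i j = 0.
Proof.
move=> ni; apply/ffunP => c; rewrite !ffunE.
by case: eqP => // ic; have := ltn_ord c.1; rewrite -ic ltnNge ni.
Qed.

Lemma taft_mono00 : taft_mono 0 0 = 1.
Proof. by apply/ffunP => c; rewrite !ffunE /= /taft_unitC eq_sym [_ == c.2]eq_sym. Qed.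

Lemma taft_monoM i j k l :
  taft_mono i j * taft_mono k l = w ^+ (j * k)%N *: taft_mono (i + k) (j + l).
Proof.
have [ni | lt_in] := leqP n i.
  by rewrite (taft_mono_ge j ni) mul0r taft_mono_ge ?scaler0 ?(leq_trans ni) ?leq_addr.
have [nk | lt_kn] := leqP n k.
  by rewrite (taft_mono_ge l nk) mulr0 taft_mono_ge ?scaler0 ?(leq_trans nk) ?leq_addl.
rewrite -[i]/(val (Ordinal lt_in)) -[k]/(val (Ordinal lt_kn)).
rewrite (taft_mono_gen (Ordinal lt_in, j)) (taft_mono_gen (Ordinal lt_kn, l)).
rewrite gen_mul; apply/ffunP => d; rewrite !ffunE /= /taft_mulC /=.
exact: mulrC.
Qed.

Lemma taft_xX i : taft_x ^+ i = taft_mono i 0.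
Proof.
elim: i => [|i IHi]; first by rewrite taft_mono00.
by rewrite exprS IHi taft_monoM mul0n scale1r add1n addr0.
Qed.

Lemma taft_gX i : taft_g ^+ i = taft_mono 0 i%:R.
Proof.
elim: i => [|i IHi]; first by rewrite taft_mono00.
by rewrite exprS IHi taft_monoM muln0 scale1r add0n mulrS.
Qed.

(* The i, j-th basis vector is indeed x^i g^j. *)
Lemma taft_genE (b : taft_data) : gen b = taft_x ^+ b.1 * taft_g ^+ b.2.
Proof.
by rewrite taft_xX taft_gX taft_monoM mul0n scale1r addn0 add0r natr_Zp taft_mono_gen.
Qed.

Lemma taft_xn : taft_x ^+ n = 0.
Proof. by rewrite taft_xX taft_mono_ge. Qed.

Lemma taft_gn : (1 < n)%N -> taft_g ^+ n = 1.
Proof. by move=> n1; rewrite taft_gX pchar_Zp // taft_mono00. Qed.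

Lemma taft_gx : (1 < n)%N -> taft_g * taft_x = w *: (taft_x * taft_g).
Proof.
move=> n1; rewrite !taft_monoM mul0n scale1r addr0 add0r !muln1 /=.
by rewrite modn_small ?expr1.
Qed.

Section TaftMap.
Variables (A : falgType K) (X G : A).

(* The linear map with x^i g^j |-> X^i G^j; it is the algebra map with x |-> X,
   g |-> G when X and G satisfy the defining relations of the Taft algebra. *)
Definition taft_map : 'Hom(taft, A) :=
  linext (fun b : taft_data => X ^+ b.1 * G ^+ b.2).

Hypotheses (n1 : (1 < n)%N) (Xn : X ^+ n = 0) (Gn : G ^+ n = 1)
  (GX : G * X = w *: (X * G)).

Lemma taft_map_mono i j : taft_map (taft_mono i j) = X ^+ i * G ^+ j.
Proof.
have [ni | lt_in] := leqP n i.
  by rewrite taft_mono_ge // linear0 -(subnK ni) exprD Xn mulr0 mul0r.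
by rewrite (taft_mono_gen (Ordinal lt_in, j)) /taft_map linext_gen.
Qed.

Lemma taft_map_x : taft_map taft_x = X.
Proof. by rewrite taft_map_mono expr1 mulr1. Qed.

Lemma taft_map_g : taft_map taft_g = G.
Proof. by rewrite taft_map_mono mul1r /= modn_small ?expr1. Qed.

Lemma taft_map_ahom : ahom_in fullv taft_map.
Proof.
have GXj j : G ^+ j * X = w ^+ j *: (X * G ^+ j).
  elim: j => [|j IHj]; first by rewrite mul1r mulr1 scale1r.
  rewrite exprS -mulrA IHj -scalerAr !mulrA GX -!scalerAl scalerA.
  by rewrite -exprSr.
have GXjk j k : G ^+ j * X ^+ k = w ^+ (j * k)%N *: (X ^+ k * G ^+ j).
  elim: k => [|k IHk]; first by rewrite mul1r mulr1 muln0 scale1r.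
  rewrite exprS mulrA GXj -scalerAl -[in LHS]mulrA IHk -scalerAr scalerA mulrA.
  by rewrite mulnS exprD.
have GZ (j l : 'Z_n) : G ^+ (j + l)%R = G ^+ j * G ^+ l.
  by rewrite -exprD /= expr_mod // Zp_cast.
apply/ahom_inP; split => [u v _ _|]; last first.
  by rewrite -taft_mono00 taft_map_mono mulr1.
rewrite {1}(gen_sum u) {1}(gen_sum v) [in RHS](gen_sum u) [in RHS](gen_sum v).
rewrite mulr_suml !linear_sum mulr_suml; apply: eq_bigr => a _.
rewrite !mulr_sumr !linear_sum; apply: eq_bigr => b _ /=.
rewrite -!scalerAl -!scalerAr !linearZ /= -scalerAl -scalerAr; congr (_ *: (_ *: _)).
rewrite -!taft_mono_gen taft_monoM linearZ /= !taft_map_mono GZ exprD.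
by rewrite -!mulrA [in RHS](mulrA (G ^+ _)) GXjk -scalerAl -scalerAr !mulrA.
Qed.

End TaftMap.

Definition taft2 := tensor taft_data taft_data.
HB.instance Definition _ := Falgebra.on taft2.

Definition taft_comul : 'Hom(taft, taft2) :=
  taft_map (tens taft_x 1 + tens taft_g taft_x) (tens taft_g taft_g).

Lemma taft_comul_rel : (1 < n)%N ->
  let X := tens taft_x 1 + tens taft_g taft_x in let G := tens taft_g taft_g in
  [/\ X ^+ n = 0, G ^+ n = 1 & G * X = w *: (X * G)].
Proof.
move=> n1 X G; rewrite /X /G; split.
- rewrite (qbinomial_prim hw) ?tensX ?taft_xn.
    by rewrite linear0 -[tens 0 _]/(tensr _ 0) linear0 addr0.
  by rewrite !tensM mulr1 mul1r taft_gx // tensZl.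
- by rewrite tensX taft_gn // tens11.
- rewrite mulrDr mulrDl !tensM scalerDr mul1r mulr1 !taft_gx // tensZl.
  by rewrite [tens _ (w *: _)]linearZ.
Qed.

Lemma taft_comul_ahom : (1 < n)%N -> ahom_in fullv taft_comul.
Proof. by move=> n1; have [Xn Gn GX] := taft_comul_rel n1; exact: taft_map_ahom. Qed.

Lemma taft_comul_x : (1 < n)%N ->
  taft_comul taft_x = tens taft_x 1 + tens taft_g taft_x.
Proof. by move=> n1; have [Xn Gn GX] := taft_comul_rel n1; exact: taft_map_x. Qed.

Lemma taft_comul_g : (1 < n)%N -> taft_comul taft_g = tens taft_g taft_g.
Proof. by move=> n1; have [Xn Gn GX] := taft_comul_rel n1; exact: taft_map_g. Qed.

(* G = Z/n is the additive group of 'Z_n, generated by 1. *)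
Definition taft_proj : 'Hom(taft, grpalg K 'Z_n) :=
  taft_map 0 (grpalg_of K (1%R : 'Z_n)).

Lemma grpalg_of_Zp i : grpalg_of K (1%R : 'Z_n) ^+ i = grpalg_of K (i%:R : 'Z_n).
Proof.
elim: i => [|i IHi]; first by rewrite expr0 -grpalg_of1.
by rewrite exprS IHi grpalg_ofM mulrS.
Qed.

Lemma taft_proj_rel : (1 < n)%N -> let G := grpalg_of K (1%R : 'Z_n) in
  [/\ (0 : grpalg K 'Z_n) ^+ n = 0, G ^+ n = 1 & G * 0 = w *: (0 * G)].
Proof.
move=> n1; split; last by rewrite mul0r mulr0 scaler0.
  by rewrite expr0n eqn0Ngt (ltnW n1).
by rewrite grpalg_of_Zp pchar_Zp // -grpalg_of1.
Qed.

Lemma taft_proj_ahom : (1 < n)%N -> ahom_in fullv taft_proj.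
Proof. by move=> n1; have [Xn Gn GX] := taft_proj_rel n1; exact: taft_map_ahom. Qed.

Definition is_subalgebra (N : {vspace taft}) : Prop :=
  1 \in N /\ (N * N <= N)%VS.

Definition left_coideal_subalgebra (N : {vspace taft}) : Prop :=
  is_subalgebra N /\ (taft_comul @: N <= tensv fullv N)%VS.

Definition right_grouplike_projection (P : taft) : Prop :=
  [/\ P != 0, P * P = P,
      taft_comul P * tens 1 P = tens P P & tens 1 P * taft_comul P = tens P P].

(* N_P = {y | Delta(y)(1 (x) P) = (1 (x) P)Delta(y) = y (x) P}; see mem_proj_coideal. *)
Definition proj_coideal (P : taft) : {vspace taft} :=
  (lker ((amulr (tens 1%R P) \o taft_comul)%VF - linfun (tensr P)) :&:
   lker ((amull (tens 1%R P) \o taft_comul)%VF - linfun (tensr P)))%VS.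

Lemma mem_proj_coideal P y : reflect
  (taft_comul y * tens 1 P = tens y P /\ tens 1 P * taft_comul y = tens y P)
  (y \in proj_coideal P).
Proof.
rewrite memv_cap !memv_ker !add_lfunE !opp_lfunE !comp_lfunE !lfunE /= !subr_eq0.
by apply: (iffP andP) => [[/eqP-> /eqP->] | [-> ->]].
Qed.

Definition coideal_dx (d : nat) : {vspace taft} :=
  <<1 & [:: (taft_g ^+ d)%R; taft_x]>>%VS.

End Taft.

Section Semisimple.
Variables (K : fieldType) (A : falgType K) (N : {vspace A}).

Definition left_ideal (I : {vspace A}) : Prop := (I <= N)%VS /\ (N * I <= I)%VS.

(* N is a semisimple left N-module: every submodule is a direct summand. *)
Definition semisimple : Prop :=
  forall I, left_ideal I ->
    exists J, [/\ left_ideal J, (I + J)%VS = N & (I :&: J)%VS = 0%VS].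

End Semisimple.

(* Main.v *)
From HB Require Import structures.
Require Import Defs.
From mathcomp Require Import all_boot all_order all_algebra all_fingroup all_field.
From mathcomp Require Import zify ring.

(** Write H for the Taft algebra and, for y in H, let L_(k,l)(y) be the result of
    applying the functional dual to x^k g^l to the first leg of Delta(y).  By the
    q-binomial formula L_(k,l) kills x^i g^j for i < k, and for i + k < n it
    sends x^(i+k) g^j to a scalar multiple of x^i g^j, the scalar being a nonzero
    q-binomial coefficient if i + j = l in Z/n and 0 otherwise ([slice_comul]).
    Hence a subspace N is a left coideal iff it is stable under all the L_(k,l)
    ([coidealP]), and everything is read off the action of these operators on
    coefficients.

    Classification.  Let N be a left coideal subalgebra.  Applied to an element
    whose top x-degree is m, the operators L_(m,j) and L_(m-1,j+1) yield g^j in N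
    ([top_coef_mono]) and, if m > 0, an element z = x + alpha g in N
    ([skew_primitive_mem]).  Stripping top terms one at a time shows that N is then
    spanned by the z^k g^j with g^j in N ([skew_power_span]).  If some
    g^j <> 1 is in N, its commutator with z is a multiple of x g^j, so that x is in
    N ([skew_commutator]).  This leaves two possibilities.
    - x is not in N.  Then the projection pi : H -> K G is injective on N: either N
      is contained in K G, or N is spanned by the powers z^k, k < n, with
      alpha <> 0, and pi(z^k) = alpha^k g^k ([proj_inj_notin_x]).  As pi(N) is the
      algebra of a subgroup G' ([proj_image]) and #|G'| divides n, which is
      invertible in K, Maschke's theorem makes N semisimple
      ([proj_inj_semisimple]).
    - x is in N.  Then N is spanned by the x^k g^j with g^j in N, that is
      N = N_(d,x) for the least d > 0 with g^d in N ([mem_x_coideal_dx]), and N is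
      not semisimple: the complement of the ideal N :&: ker pi would give
      x = x a with a in ker pi, but then x a has no term of x-degree 1
      ([x_not_semisimple]).

    Projections.  A nonzero idempotent P is a right group-like projection iff
    P \in N_P, and y P = P y = eps(y) P for y in N_P ([proj_coideal_act]), eps being
    the counit.  So eps(P) = 1, and if N_P = N_Q then P = P Q = Q.  That N_P is
    a left coideal is coassociativity, which appears as the composition rule
    [lower_lower] of the operators L_(k,l).  If x were in N_P then x P = 0, which
    kills all coefficients of P of x-degree 0 and contradicts eps(P) = 1; so N_P is
    semisimple.  Conversely, if N is semisimple, the component P of 1 in a complement
    of ker eps is a two-sided integral of N because N, embedded in K G by pi,
    is commutative ([semisimple_integral]); then N <= N_P, and any h in G with
    h * pi(P) = pi(P) lies in the subgroup G' supporting pi(P), which forces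
    N_P = N ([semisimple_proj_coideal]). *)

Set Implicit Arguments.
Unset Strict Implicit.
Unset Printing Implicit Defensive.

Import GRing.Theory.
Local Open Scope ring_scope.

(** * Slices of tensors *)

Section Slice.
Variables (K : fieldType) (D E : algData K).
Implicit Types (t : tensor D E) (a : D) (v : alg E) (N : {vspace alg E}).

(** The functional dual to the basis vector a, applied to the first factor. *)
Definition slice a t : alg E := [ffun b => t (a, b)].

Fact slice_linear a : linear (slice a).
Proof. by move=> k t t'; apply/ffunP => b; rewrite !ffunE. Qed.
HB.instance Definition _ a := GRing.isLinear.Build K (tensor D E) (alg E) _
  (slice a) (@slice_linear a).

Lemma slice_tens a u v : slice a (tens u v) = u a *: v.
Proof. by apply/ffunP => b; rewrite !ffunE. Qed.

Lemma tens_slice t : t = \sum_a tens (gen a) (slice a t).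
Proof.
apply/ffunP => -[a b]; rewrite sum_ffunE.
under eq_bigr do rewrite !ffunE /= mulrC.
by rewrite (sum_delta (fun a => t (a, b))).
Qed.

Lemma slice_inj t t' : (forall a, slice a t = slice a t') -> t = t'.
Proof.
move=> eq_tt'; rewrite [t]tens_slice [t']tens_slice.
by apply: eq_bigr => a _; rewrite eq_tt'.
Qed.

Lemma slice_tens_sum a (F : D -> alg E) :
  slice a (\sum_b tens (gen b) (F b)) = F a.
Proof.
rewrite linear_sum (bigD1 a) //= big1 ?addr0 => [|b /negPf neq_ba].
  by rewrite slice_tens ffunE eqxx scale1r.
by rewrite slice_tens ffunE neq_ba scale0r.
Qed.

Lemma slice_mul1r a t v : slice a (t * tens 1 v) = slice a t * v.
Proof.
rewrite {1}[t]tens_slice mulr_suml; under eq_bigr do rewrite tensM mulr1.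
exact: (slice_tens_sum a (fun b => slice b t * v)).
Qed.

Lemma slice_mul1l a t v : slice a (tens 1 v * t) = v * slice a t.
Proof.
rewrite {1}[t]tens_slice mulr_sumr; under eq_bigr do rewrite tensM mul1r.
exact: (slice_tens_sum a (fun b => v * slice b t)).
Qed.

(** A tensor lies in A (x) N as soon as all its slices along a basis of A
    do: this is what turns left coideals into subspaces stable under operators. *)
Lemma mem_tensvP N t :
  reflect (forall a, slice a t \in N) (t \in tensv fullv N).
Proof.
apply: (iffP idP) => [tN a | tN]; last first.
  by rewrite [t]tens_slice memv_suml // => a _; rewrite memv_tens ?memvf.
pose X := [seq tens u v | u <- vbasis (fullv : {vspace alg D}), v <- vbasis N].
have /coord_span -> : t \in <<in_tuple X>>%VS by [].
rewrite linear_sum memv_suml //= => i _; rewrite linearZ memvZ //=.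
have /allpairsP [[u v] [_ /= vN ->]] := mem_nth (0 : tensor D E) (ltn_ord i).
by rewrite slice_tens memvZ // vbasis_mem.
Qed.

Lemma tensv_closed N :
  (N * N <= N)%VS ->
  (tensv (fullv : {vspace alg D}) N * tensv fullv N <= tensv fullv N)%VS.
Proof.
move=> /prodvP NN; apply/prodvP => t t' /mem_tensvP tN /mem_tensvP t'N.
rewrite [t]tens_slice [t']tens_slice mulr_suml memv_suml // => a _.
rewrite mulr_sumr memv_suml // => b _.
by rewrite tensM memv_tens ?memvf ?NN.
Qed.

End Slice.

(** * q-binomial coefficients *)

Section QFactorial.
Variables (K : fieldType) (w : K).

(** The q-factorial [m]! multiplied by (1 - w)^m, a form without denominators. *)
Definition qfact (m : nat) : K := \prod_(i < m) (1 - w ^+ i.+1).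

(** Turns the recursive coefficients into ratios of q-factorials. *)
Lemma qbinom_fact i j : qbinom w i j * (qfact i * qfact j) = qfact (i + j).
Proof.
elim: i j => [|i IHi] j; first by rewrite qbinom0i /qfact big_ord0 !mul1r.
rewrite addSnnS -IHi [qfact i.+1]big_ord_recr [qfact j.+1]big_ord_recr /=.
rewrite -/(qfact i) -/(qfact j) [_ * (1 - w ^+ i.+1)]mulrC -mulrA mulrA.
by rewrite qbinom_shift -!mulrA; congr (_ * _); rewrite mulrCA [(1 - _) * _]mulrC.
Qed.

Variables (n : nat) (hw : n.-primitive_root w).

Lemma qfact_neq0 m : (m < n)%N -> qfact m != 0.
Proof.
move=> lt_mn; apply/prodf_neq0 => i _; rewrite subr_eq0 eq_sym -(expr0 w).
by rewrite (eq_prim_root_expr hw) mod0n modn_small // (leq_ltn_trans (ltn_ord i)).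
Qed.

Lemma qbinom_neq0 i j : (i + j < n)%N -> qbinom w i j != 0.
Proof.
move=> lt_n; apply: contraNneq (qfact_neq0 lt_n) => q0.
by rewrite -qbinom_fact q0 mul0r.
Qed.

(** Both sides are the q-multinomial coefficient [i+j+k]! / ([i]! [j]! [k]!);
    the bound keeps all q-factorials nonzero. *)
Lemma qbinom_assoc i j k : (i + j + k < n)%N ->
  qbinom w i (j + k) * qbinom w j k = qbinom w i j * qbinom w (i + j) k.
Proof.
move=> lt_n; have F a : (a <= i + j + k)%N -> qfact a != 0.
  by move=> le_a; rewrite qfact_neq0 // (leq_ltn_trans le_a).
have nz : qfact i * (qfact j * qfact k) * qfact (j + k) * qfact (i + j) != 0.
  by rewrite !mulf_neq0 ?F //; lia.
have e1 := qbinom_fact i (j + k); have e2 := qbinom_fact j k.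
have e3 := qbinom_fact i j; have e4 := qbinom_fact (i + j) k.
apply: (mulIf nz); rewrite addnA in e1.
transitivity (qfact (i + j + k) * qfact (j + k) * qfact (i + j)).
  by rewrite -{2}e2 -e1; ring.
by rewrite -{1}e3 -e4; ring.
Qed.

End QFactorial.

(** * The coproduct in coordinates *)

Section Coordinates.
Variables (K : fieldType) (n : nat) (w : K) (hw : n.-primitive_root w).
Implicit Types (u v y P : taft hw) (N : {vspace taft hw}) (i k : nat) (j l : 'Z_n).

(** The index i ranges over the natural numbers, with value 0 from n on, so that
    x-degrees can be shifted freely. *)
Definition tcoef i j y : K :=
  oapp (fun i' : 'I_n => y (i', j)) 0 (insub i).

Lemma tcoefE y (b : taft_data hw) : tcoef b.1 b.2 y = y b.
Proof. by rewrite /tcoef valK; case: b. Qed.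

Lemma tcoef_ge i j y : (n <= i)%N -> tcoef i j y = 0.
Proof. by move=> le_ni; rewrite /tcoef insubF // ltnNge le_ni. Qed.

Fact tcoef_linear i j : linear (tcoef i j : taft hw -> K^o).
Proof.
move=> c u v; rewrite /tcoef; case: insubP => [i' _ _|_] /=.
  by rewrite !ffunE.
by rewrite scaler0 addr0.
Qed.
HB.instance Definition _ i j := GRing.isLinear.Build K (taft hw) K^o _
  (tcoef i j) (@tcoef_linear i j).

Lemma tcoef_sum i j (I : Type) (r : seq I) (Q : pred I) (F : I -> taft hw) :
  tcoef i j (\sum_(a <- r | Q a) F a) = \sum_(a <- r | Q a) tcoef i j (F a).
Proof. exact: linear_sum. Qed.

Lemma tcoefZ i j (c : K) y : tcoef i j (c *: y) = c * tcoef i j y.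
Proof. exact: linearZ. Qed.

Lemma tcoefD i j u v : tcoef i j (u + v) = tcoef i j u + tcoef i j v.
Proof. exact: linearD. Qed.

Lemma tcoefB i j u v : tcoef i j (u - v) = tcoef i j u - tcoef i j v.
Proof. exact: linearB. Qed.

Lemma tcoef0 i j : tcoef i j 0 = 0.
Proof. exact: linear0. Qed.

Lemma tcoef_mono i j k l :
  tcoef i j (taft_mono hw k l) = ([&& i < n, k == i & l == j])%N%:R.
Proof.
rewrite /tcoef; case: insubP => [i' lt_in <-|/negPf ->] //=.
by rewrite ffunE ltn_ord.
Qed.

Lemma tcoefP u v :
  (forall i j, (i < n)%N -> tcoef i j u = tcoef i j v) -> u = v.
Proof. by move=> eq_uv; apply/ffunP => b; rewrite -!tcoefE eq_uv. Qed.

Lemma tcoef_neq0 y : y != 0 -> exists i j, tcoef i j y != 0.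
Proof.
move=> nz_y; have [b nz_b] : exists b, y b != 0.
  apply/existsP; apply: contraNT nz_y; rewrite negb_exists => /forallP y0.
  by apply/eqP/ffunP => b; rewrite ffunE; apply/eqP; rewrite -[_ == _]negbK.
by exists b.1, b.2; rewrite tcoefE.
Qed.

Lemma taft_sum_mono y :
  y = \sum_(b : taft_data hw) tcoef b.1 b.2 y *: taft_mono hw b.1 b.2.
Proof.
rewrite {1}[y]gen_sum; apply: eq_bigr => b _.
by rewrite tcoefE taft_mono_gen.
Qed.

(** Lowers x-degrees by k: the slice at x^k g^l of the coproduct, by [slice_comul].
    For k >= n it is zero. *)
Definition lower k l y : taft hw :=
  [ffun b : taft_data hw =>
     ((b.1%:R + b.2 == l :> 'Z_n)%:R * qbinom w k b.1) * tcoef (b.1 + k) b.2 y].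

Fact lower_linear k l : linear (lower k l).
Proof.
move=> c u v; apply/ffunP => b; rewrite !ffunE linearP mulrDr; congr (_ + _).
by rewrite /GRing.scale /= mulrCA.
Qed.
HB.instance Definition _ k l := GRing.isLinear.Build K (taft hw) (taft hw) _
  (lower k l) (@lower_linear k l).

Lemma tcoef_lower i j k l y :
  tcoef i j (lower k l y) =
    (i%:R + j == l)%:R * qbinom w k i * tcoef (i + k) j y.
Proof.
rewrite {1}/tcoef; case: insubP => [i' _ <-|]; first by rewrite /= ffunE.
rewrite -leqNgt => le_ni; rewrite /= tcoef_ge ?mulr0 //.
by rewrite (leq_trans le_ni) ?leq_addr.
Qed.

Hypothesis n1 : (1 < n)%N.

(** In Delta(x)^i Delta(g)^j, expanded by the q-binomial formula, the only term whose
    first factor is a multiple of x^k g^l has second factor x^(i-k) g^j, and it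
    occurs iff (i - k) + j = l in Z/n. *)
Lemma slice_comul (a : taft_data hw) y :
  slice a (taft_comul hw y) = lower a.1 a.2 y.
Proof.
rewrite [y]taft_sum_mono !linear_sum; apply: eq_bigr => -[i j] _ /=.
rewrite !linearZ /=; congr (_ *: _).
have [Xn Gn GX] := taft_comul_rel hw n1.
rewrite (taft_map_mono hw _ Xn).
have YX : tens (taft_g hw) (taft_x hw) * tens (taft_x hw) 1
    = w *: (tens (taft_x hw) 1 * tens (taft_g hw) (taft_x hw)).
  by rewrite !tensM mulr1 mul1r taft_gx // tensZl.
rewrite (qbinomial _ YX) mulr_suml.
have mono_term (s : 'I_i.+1) :
  qbinom w s (i - s) *: (tens (taft_x hw) 1 ^+ s
     * tens (taft_g hw) (taft_x hw) ^+ (i - s)) * tens (taft_g hw) (taft_g hw) ^+ j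
  = qbinom w s (i - s) *:
     tens (taft_mono hw s ((i - s)%:R + j)) (taft_mono hw (i - s) j).
  rewrite -scalerAl !tensX !tensM expr1n mul1r; congr (_ *: tens _ _).
    rewrite taft_xX !taft_gX natr_Zp !taft_monoM.
    by rewrite !muln0 !scale1r !add0r !addn0 taft_monoM muln0 scale1r addn0.
  by rewrite taft_xX taft_gX natr_Zp taft_monoM mul0n scale1r addn0 add0r.
rewrite (eq_bigr _ (fun s _ => mono_term s)) linear_sum /=.
apply: tcoefP => i' j' lt_in'; rewrite linear_sum /=.
have tcoef_term (s : 'I_i.+1) :
  tcoef i' j' (slice a (qbinom w s (i - s) *:
     tens (taft_mono hw s ((i - s)%:R + j)) (taft_mono hw (i - s) j)))
  = qbinom w s (i - s) * ((s == a.1 :> nat) && ((i - s)%:R + j == a.2))%:R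
     * ((i - s == i') && (j == j'))%N%:R.
  rewrite linearZ linearZ /= slice_tens linearZ /= tcoef_mono ffunE lt_in' /=.
  exact: mulrA.
rewrite (eq_bigr _ (fun s _ => tcoef_term s)) tcoef_lower tcoef_mono.
have -> : (i' + a.1 < n)%N && ((i == i' + a.1 :> nat)%N && (j == j'))
    = (i == i' + a.1 :> nat)%N && (j == j').
  by case: eqP => [<-|]; rewrite ?ltn_ord // andbF.
have [/andP [/eqP ei /eqP ej]|] := boolP (_ && _); last first.
  move=> ne; rewrite mulr0 big1 // => s _; have := ltn_ord s; rewrite ltnS => le_si.
  case: (s =P a.1 :> nat) => [es|_]; last by rewrite mulr0 mul0r.
  rewrite (_ : _ && (j == j') = false) ?mulr0 //; apply: contraNF ne.
  by move=> /andP [/eqP <- ->]; rewrite -es subnK ?eqxx.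
have lt_s : (a.1 < i.+1)%N by rewrite ei ltnS leq_addl.
rewrite (bigD1 (Ordinal lt_s)) //= big1 ?addr0 => [|s ne_s].
  rewrite ei ej addnK !eqxx /=; congr (_ * _); exact: mulrC.
rewrite (_ : (s == a.1 :> nat) = false) ?mulr0 ?mul0r //.
by apply: contraNF ne_s => /eqP es; apply/eqP/val_inj.
Qed.

Lemma lower_ge k l y : (n <= k)%N -> lower k l y = 0.
Proof.
move=> le_nk; apply: tcoefP => i j _.
by rewrite tcoef_lower linear0 tcoef_ge ?mulr0 // (leq_trans le_nk) ?leq_addl.
Qed.

Lemma coidealP N :
  (taft_comul hw @: N <= tensv fullv N)%VS <->
  (forall y k l, y \in N -> lower k l y \in N).
Proof.
split=> [/subvP coN y k l yN | lowN].
  have [lt_kn|le_nk] := ltnP k n; last by rewrite lower_ge ?mem0v.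
  have /mem_tensvP/(_ (Ordinal lt_kn, l)) := coN _ (memv_img (taft_comul hw) yN).
  by rewrite slice_comul.
apply/subvP => _ /memv_imgP [y yN ->]; apply/mem_tensvP => a.
by rewrite slice_comul lowN.
Qed.

Lemma proj_coidealP P y :
  reflect (forall k l, lower k l y * P = tcoef k l y *: P /\
                       P * lower k l y = tcoef k l y *: P)
          (y \in proj_coideal P).
Proof.
apply: (iffP (mem_proj_coideal P y)) => [[yP Py] k l | yP].
  have [lt_kn|le_nk] := ltnP k n; last first.
    by rewrite lower_ge ?tcoef_ge // mulr0 mul0r scale0r.
  pose a : taft_data hw := (Ordinal lt_kn, l).
  have := slice_comul a y; rewrite /= => <-.
  rewrite -slice_mul1r -slice_mul1l yP Py.
  by rewrite slice_tens -(tcoefE y a).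
split; apply: slice_inj => a; rewrite (slice_mul1l, slice_mul1r) slice_comul slice_tens;
  by rewrite -tcoefE; have [] := yP a.1 a.2.
Qed.

(** Coassociativity in coordinates; the q-binomial coefficients match by
    [qbinom_assoc]. *)
Lemma lower_lower k l k' l' y :
  lower k' l' (lower k l y) =
    ((k'%:R + l' == l)%:R * qbinom w k k') *: lower (k' + k) l' y.
Proof.
apply: tcoefP => i j lt_i.
rewrite linearZ /= !tcoef_lower -addnA.
have [lt_n|le_n] := ltnP (i + (k' + k)) n; last by rewrite tcoef_ge ?mulr0 ?scaler0.
rewrite /GRing.scale /= !mulrA; congr (_ * _).
have [<-|_] := eqVneq (i%:R + j) l'; last by rewrite ?(mul0r, mulr0).
rewrite (natrD _ i) addrCA addrA.
have assoc : qbinom w k (k' + i) * qbinom w k' i =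
    qbinom w k k' * qbinom w (k + k') i.
  by apply: (qbinom_assoc hw); lia.
rewrite mul1r (addnC i k') (addnC k' k) mulr1.
by rewrite -mulrA -[RHS]mulrA -assoc mulrCA [qbinom w k' i * _]mulrC.
Qed.

(** Stability under products holds because 1 (x) P commutes with y (x) 1 for
    all y; stability under the operators is the composition rule [lower_lower]. *)
Lemma proj_coideal_subalgebra P : left_coideal_subalgebra (proj_coideal P).
Proof.
have /ahom_inP [DM D1] := taft_comul_ahom hw n1.
split; [split|].
- by apply/mem_proj_coideal; rewrite D1 mulr1 mul1r.
- apply/prodvP => u v /mem_proj_coideal [uP Pu] /mem_proj_coideal [vP Pv].
  apply/mem_proj_coideal; rewrite DM ?memvf //; split.
    have -> : tens (u * v) P = tens u P * tens v 1 by rewrite tensM mulr1.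
    by rewrite -uP -!mulrA vP tensM mul1r mulr1.
  have -> : tens (u * v) P = tens u 1 * tens v P by rewrite tensM mul1r.
  by rewrite -Pv !mulrA Pu tensM mulr1 mul1r.
- apply/coidealP => y k l /proj_coidealP yN; apply/proj_coidealP => k' l'.
  have [yP Py] := yN (k' + k)%N l'.
  by rewrite lower_lower tcoef_lower -scalerAl -scalerAr yP Py scalerA.
Qed.

(** * The counit *)

(** The counit of H, obtained as an algebra map to K so that it is multiplicative by
    construction. *)
Definition taft_counit : 'Hom(taft hw, K^o) := taft_map hw (0 : K^o) 1.

Lemma taft_counitE y : taft_counit y = \sum_(j : 'Z_n) tcoef 0 j y.
Proof.
rewrite [y]taft_sum_mono !linear_sum.
under [RHS]eq_bigr do rewrite linear_sum.
rewrite exchange_big; apply: eq_bigr => -[i j] _ /=.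
rewrite linearZ /= taft_map_mono ?expr0n ?expr1n ?mulr1 //; last first.
  by rewrite -[n]prednK ?exprSr ?mulr0 // ltnW.
under [RHS]eq_bigr do rewrite linearZ /= tcoef_mono ltnW //=.
rewrite (bigD1 j) //= eqxx big1 ?addr0 => [|j' /negPf ne].
  by rewrite andbT.
by rewrite (eq_sym j) ne andbF scaler0.
Qed.

Lemma taft_counit_ahom : ahom_in fullv taft_counit.
Proof.
apply: taft_map_ahom => //; rewrite ?expr1n ?mulr0 ?mul0r ?scaler0 //.
by rewrite -[n]prednK ?exprSr ?mulr0 // ltnW.
Qed.

Lemma taft_counitM : {morph taft_counit : u v / u * v}.
Proof.
by have /ahom_inP [M _] := taft_counit_ahom; move=> u v; apply: M; rewrite memvf.
Qed.

Lemma taft_counit1 : taft_counit 1 = 1.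
Proof. by have /ahom_inP [] := taft_counit_ahom. Qed.

(** The counit axiom (eps (x) id) Delta = id. *)
Lemma sum_lower0 y : \sum_l lower 0 l y = y.
Proof.
apply: tcoefP => i j lt_i; rewrite linear_sum /=.
under eq_bigr do rewrite tcoef_lower addn0 qbinom0i mulr1.
rewrite (bigD1 (i%:R + j)) //= eqxx mul1r big1 ?addr0 // => l ne.
by rewrite eq_sym (negPf ne) mul0r.
Qed.

(** The counit axiom (id (x) eps) Delta = id. *)
Lemma counit_lower k l y : taft_counit (lower k l y) = tcoef k l y.
Proof.
rewrite taft_counitE; under eq_bigr do rewrite tcoef_lower add0r qbinomi0 mulr1 add0n.
rewrite (bigD1 l) //= eqxx mul1r big1 ?addr0 // => j ne.
by rewrite (negPf ne) mul0r.
Qed.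

(** * Right group-like projections *)

(** Apply eps to the first leg of the equations defining N_P. *)
Lemma proj_coideal_act P y : y \in proj_coideal P ->
  y * P = taft_counit y *: P /\ P * y = taft_counit y *: P.
Proof.
move=> /proj_coidealP yP; rewrite -{1 3}[y]sum_lower0 taft_counitE scaler_suml.
rewrite mulr_suml mulr_sumr.
by split; apply: eq_bigr => l _; have [] := yP 0%N l.
Qed.

(** A two-sided integral P of N satisfies the defining equations of N_P on N,
    because the second legs of Delta(N) stay in N, where they act on P by eps. *)
Lemma sub_proj_coideal N P : left_coideal_subalgebra N ->
  (forall y, y \in N -> y * P = taft_counit y *: P /\ P * y = taft_counit y *: P) ->
  (N <= proj_coideal P)%VS.
Proof.
move=> [_ /coidealP lowN] NP; apply/subvP => y yN; apply/proj_coidealP => k l.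
by rewrite -counit_lower; apply/NP/lowN.
Qed.

Lemma grouplike_projectionP P :
  right_grouplike_projection P <-> [/\ P != 0, P * P = P & P \in proj_coideal P].
Proof.
split=> [[nzP PP DP PD]|[nzP PP /mem_proj_coideal [DP PD]]]; split=> //.
exact/mem_proj_coideal.
Qed.

(** Since P is in N_P, P = P P = eps(P) P. *)
Lemma grouplike_projection_counit P :
  right_grouplike_projection P -> taft_counit P = 1.
Proof.
move=> /grouplike_projectionP [nzP PP /proj_coideal_act [actP _]].
apply/eqP; rewrite -subr_eq0; move: (nzP); apply: contraNT => nz_c.
by rewrite -(inj_eq (scalerI nz_c)) scaler0 scalerBl -actP PP scale1r subrr.
Qed.

(** Each of P and Q lies in the common algebra and acts on the other by its
    counit, which is 1: hence P = P Q = Q. *)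
Lemma proj_coideal_inj P Q :
  right_grouplike_projection P -> right_grouplike_projection Q ->
  proj_coideal P = proj_coideal Q -> P = Q.
Proof.
move=> gP gQ eqPQ.
have /grouplike_projectionP [_ _ NP] := gP.
have /grouplike_projectionP [_ _ NQ] := gQ.
rewrite eqPQ in NP; rewrite -eqPQ in NQ.
have [PQ _] := proj_coideal_act NP; have [_ PQ'] := proj_coideal_act NQ.
rewrite !grouplike_projection_counit // !scale1r in PQ PQ'.
by rewrite -PQ -{1}PQ'.
Qed.

End Coordinates.

(** * Maschke's theorem *)

Section Maschke.
Variables (K : fieldType) (A : falgType K) (gT : finGroupType) (G : {group gT}).
Variables (f : gT -> A).
Hypotheses (cardG : #|G|%:R != 0 :> K) (f1 : f 1%g = 1).
Hypothesis fM : {in G &, forall a b, f (a * b)%g = f a * f b}.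

Let N := <<[seq f h | h <- enum G]>>%VS.

(** The usual averaging argument: the average p over G of the conjugates of a
    linear projection onto I is an N-linear projection onto I, and its kernel in N
    is a complement of I. *)
Lemma maschke_span : semisimple N.
Proof.
move=> I [subIN /prodvP NI].
have fN h : h \in G -> f h \in N by move=> Gh; rewrite memv_span // map_f // mem_enum.
have fV h : h \in G -> f h * f h^-1%g = 1 by move=> Gh; rewrite -fM ?groupV // mulgV.
pose p : 'End(A) := #|G|%:R^-1 *:
  \sum_(h in G) (amull (f h) \o projv I \o amull (f h^-1%g))%VF.
have pE u : p u = #|G|%:R^-1 *: \sum_(h in G) f h * projv I (f h^-1%g * u).
  rewrite scale_lfunE sum_lfunE; congr (_ *: _); apply: eq_bigr => h _.
  by rewrite !comp_lfunE !lfunE.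
have pI u : p u \in I.
  by rewrite pE memvZ // memv_suml // => h Gh; rewrite NI ?fN ?memv_proj.
have p_id u : u \in I -> p u = u.
  move=> Iu; rewrite pE (eq_bigr (fun=> u)) => [|h Gh].
    by rewrite sumr_const -scaler_nat scalerA mulVf ?scale1r.
  by rewrite projv_id ?NI ?fN ?groupV // mulrA fV ?mul1r.
have pf k u : k \in G -> p (f k * u) = f k * p u.
  move=> Gk; rewrite !pE -scalerAr mulr_sumr; congr (_ *: _).
  rewrite (reindex_inj (mulgI k)) /=; apply: eq_big => [h|h]; rewrite groupMl // => Gh.
  rewrite fM // -mulrA; congr (_ * (_ * projv I _)).
  by rewrite mulrA -fM ?groupV ?groupM // invMg -mulgA mulVg mulg1.
have pN a u : a \in N -> p (a * u) = a * p u.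
  move=> Na; have /coord_span -> : a \in <<in_tuple [seq f h | h <- enum G]>>%VS by [].
  rewrite !mulr_suml linear_sum; apply: eq_bigr => i _ /=.
  rewrite -!scalerAl linearZ /=; congr (_ *: _).
  have /mapP [h] := mem_nth (0 : A) (ltn_ord i).
  by rewrite mem_enum => Gh ->; apply: pf.
have NN a u : a \in N -> u \in N -> a * u \in N.
  move=> Na Nu; have /coord_span -> : a \in <<in_tuple [seq f h | h <- enum G]>>%VS by [].
  have /coord_span -> : u \in <<in_tuple [seq f h | h <- enum G]>>%VS by [].
  rewrite mulr_suml memv_suml // => i _; rewrite mulr_sumr memv_suml // => j _.
  rewrite -scalerAl -scalerAr !memvZ //.
  have /mapP [h Gh /= ->] := mem_nth (0 : A) (ltn_ord i).
  have /mapP [k Gk /= ->] := mem_nth (0 : A) (ltn_ord j).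
  by rewrite !mem_enum in Gh Gk; rewrite -fM // fN ?groupM.
exists (N :&: lker p)%VS; split.
- split; first exact: capvSl.
  apply/prodvP => a u Na; rewrite !memv_cap !memv_ker => /andP [Nu /eqP pu].
  rewrite pN // pu mulr0 eqxx andbT; exact: NN.
- apply: subv_anti; rewrite subv_add subIN capvSl /=; apply/subvP => u Nu.
  have Npu : p u \in N by rewrite (subvP subIN).
  rewrite -[u](subrK (p u)) addrC memv_add // memv_cap memvB //=.
  by rewrite memv_ker linearB /= (p_id (p u)) ?subrr.
- apply: subv_anti; rewrite sub0v andbT; apply/subvP => u; rewrite !memv_cap memv_ker.
  by case/and3P=> Iu _; rewrite p_id // memv0.
Qed.

End Maschke.

(** * The projection onto the group algebra *)

Section Projection.
Variables (K : fieldType) (n : nat) (w : K) (hw : n.-primitive_root w).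
Hypothesis n1 : (1 < n)%N.
Implicit Types (u v y P : taft hw) (N : {vspace taft hw}) (i k : nat) (j l : 'Z_n).

Lemma taft_projE y j : taft_proj hw y j = tcoef 0 j y.
Proof.
rewrite [y]taft_sum_mono !linear_sum sum_ffunE tcoef_sum; apply: eq_bigr => -[i l] _ /=.
rewrite linearZ tcoefZ ffunE; congr (_ * _).
have [X0 _ _] := taft_proj_rel w n1.
rewrite /= /taft_proj (taft_map_mono hw _ X0) grpalg_of_Zp natr_Zp tcoef_mono (ltnW n1) /=.
case: (nat_of_ord i) => [|i']; first by rewrite mul1r ffunE.
by rewrite expr0n mul0r ffunE.
Qed.

Lemma taft_projM : {morph taft_proj hw : u v / u * v}.
Proof.
have /ahom_inP [M _] := taft_proj_ahom hw n1.
by move=> u v; apply: M; rewrite memvf.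
Qed.

Lemma taft_proj1 : taft_proj hw 1 = 1.
Proof. by have /ahom_inP [] := taft_proj_ahom hw n1. Qed.

Lemma proj_lower0 j y : taft_proj hw (lower 0 j y) = tcoef 0 j y *: grpalg_of K j.
Proof.
apply/ffunP => l; rewrite taft_projE tcoef_lower add0r qbinomi0 mulr1 !ffunE.
by rewrite eq_sym mulrC; have [->|_] := eqVneq j l; rewrite ?mulr0 // scaler0.
Qed.

(** N is stable under the projections of H onto its homogeneous parts for the
    Z/n-grading where x^i g^j has degree i + j, and pi maps the part of degree j to
    the line through g^j. *)
Lemma proj_image N : left_coideal_subalgebra N ->
  exists G' : {group 'Z_n}, (taft_proj hw @: N)%VS = subgrpalg K G'.
Proof.
move=> [[N1 /prodvP NN] /(coidealP n1) lowN].
pose A := [set h : 'Z_n | grpalg_of K h \in (taft_proj hw @: N)%VS].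
have groupA : group_set A.
  apply/group_setP; split=> [|a b]; rewrite !inE.
    by rewrite grpalg_of1 -taft_proj1 memv_img.
  move=> /memv_imgP [u uN ea] /memv_imgP [v vN eb].
  by rewrite -grpalg_ofM ea eb -taft_projM memv_img ?NN.
exists (Group groupA); apply: subv_anti; apply/andP; split; last first.
  by apply/span_subvP => _ /mapP [h Ah ->]; move: Ah; rewrite mem_enum inE.
apply/subvP => _ /memv_imgP [y yN ->].
rewrite -[y](sum_lower0) linear_sum memv_suml // => j _ /=.
rewrite proj_lower0; have [->|nz] := eqVneq (tcoef 0 j y) 0.
  by rewrite scale0r mem0v.
rewrite memvZ // memv_span // map_f // mem_enum inE.
rewrite -[grpalg_of K j](scalerK nz) -proj_lower0.
by rewrite memvZ // memv_img // lowN.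
Qed.

(** The preimages in N of the elements of G' multiply as in G' and span N, so that
    Maschke's theorem applies; #|G'| divides n, and n is invertible in K because K
    contains a primitive n-th root of unity. *)
Lemma proj_inj_semisimple N : left_coideal_subalgebra N ->
  {in N &, injective (taft_proj hw)} -> semisimple N.
Proof.
move=> coN inj; have [G' imN] := proj_image coN.
have [[N1 /prodvP NN] _] := coN.
have [f fP] : exists f : 'Z_n -> taft hw,
    forall h, h \in G' -> f h \in N /\ taft_proj hw (f h) = grpalg_of K h.
  apply: (@fin_all_exists _ (fun=> taft hw)
    (fun h y => h \in G' -> y \in N /\ taft_proj hw y = grpalg_of K h)) => h.
  have [Gh|_] := boolP (h \in G'); last by exists 0.
  have : grpalg_of K h \in (taft_proj hw @: N)%VS.
    by rewrite imN memv_span // map_f // mem_enum.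
  by case/memv_imgP=> y yN ->; exists y.
have fN h (Gh : h \in G') : f h \in N by have [] := fP h Gh.
have pf h (Gh : h \in G') : taft_proj hw (f h) = grpalg_of K h by have [] := fP h Gh.
have spanN : N = <<[seq f h | h <- enum G']>>%VS.
  have sub : (<<[seq f h | h <- enum G']>> <= N)%VS.
    by apply/span_subvP => _ /mapP [h Gh ->]; apply: fN; rewrite mem_enum in Gh.
  apply: subv_anti; rewrite sub andbT; apply/subvP => y yN.
  have : taft_proj hw y \in (taft_proj hw @: <<[seq f h | h <- enum G']>>)%VS.
    rewrite limg_span -map_comp.
    have -> : [seq (taft_proj hw \o f) h | h <- enum G']
        = [seq grpalg_of K h | h <- enum G'].
      by apply/eq_in_map => h; rewrite mem_enum => Gh; apply: pf.
    by rewrite -/(subgrpalg K G') -imN memv_img.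
  by case/memv_imgP=> u uS eq_yu; rewrite (inj _ _ yN (subvP sub _ uS) eq_yu).
rewrite spanN; apply: maschke_span.
- have /dvdnP [q en] : (#|G'| %| n)%N.
    by have := cardSg (subsetT G'); rewrite cardsT card_ord Zp_cast.
  apply: contraNneq (prim_root_natf_neq0 hw) => G0.
  by rewrite [X in X%:R]en natrM G0 mulr0.
- by apply: inj; rewrite ?fN ?group1 // pf ?group1 // taft_proj1 grpalg_of1.
- move=> a b Ga Gb; apply: inj; rewrite ?NN ?fN ?groupM //.
  by rewrite taft_projM !pf ?groupM // grpalg_ofM.
Qed.

End Projection.

(** * Coefficients in group algebras *)

Section GroupAlgebraCoefficients.
Variables (K : fieldType) (gT : finGroupType).
Implicit Types (u : grpalg K gT) (h k : gT).

Lemma subgrpalg_coef (A : {set gT}) u h :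
  u \in subgrpalg K A -> u h != 0 -> h \in A.
Proof.
move=> uA; apply: contraR => hA.
have /coord_span -> : u \in <<in_tuple [seq grpalg_of K h | h <- enum A]>>%VS by [].
rewrite sum_ffunE big1 // => i _.
have /mapP [k /= + ->] := mem_nth (0 : grpalg K gT) (ltn_ord i).
rewrite mem_enum ffunE => kA; rewrite ffunE (_ : (k == h) = false) ?scaler0 //.
by apply: contraNF hA => /eqP <-.
Qed.

Lemma grpalg_of_mul_coef h k u : (grpalg_of K h * u) (h * k)%g = u k.
Proof.
rewrite [u]gen_sum mulr_sumr !sum_ffunE; apply: eq_bigr => a _.
rewrite -scalerAr -[gen a]/(grpalg_of K a) grpalg_ofM !ffunE.
by rewrite (inj_eq (mulgI h)).
Qed.

End GroupAlgebraCoefficients.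

Lemma grpalg_Zp_comm (K : fieldType) n (u v : grpalg K 'Z_n) : u * v = v * u.
Proof.
apply/ffunP => d; rewrite !ffunE exchange_big /=; apply: eq_bigr => a _.
apply: eq_bigr => b _; rewrite (mulrC (u b)); congr (_ * _).
rewrite /= /grp_mulC; congr (_ == _)%:R; exact: addrC.
Qed.

(** * Left coideal subalgebras of the Taft algebra *)

Section Classification.
Variables (K : fieldType) (n : nat) (w : K) (hw : n.-primitive_root w).
Hypothesis n1 : (1 < n)%N.
Implicit Types (u v y P : taft hw) (N V : {vspace taft hw}) (i k m : nat).
Implicit Types (j l : 'Z_n) (alpha : K).

Local Notation x := (taft_x hw).
Local Notation g := (taft_g hw).

Lemma tcoef_xM i j y : (i.+1 < n)%N -> tcoef i.+1 j (x * y) = tcoef i j y.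
Proof.
move=> lt_i; rewrite [y]taft_sum_mono mulr_sumr !tcoef_sum.
apply: eq_bigr => -[i' j'] _ /=; rewrite -scalerAr !tcoefZ taft_monoM.
by rewrite mul0n scale1r add0r add1n !tcoef_mono eqSS lt_i (ltnW lt_i).
Qed.

Lemma tcoef_gM i j y : tcoef i j (g * y) = w ^+ i * tcoef i (j - 1) y.
Proof.
rewrite [y]taft_sum_mono mulr_sumr !tcoef_sum mulr_sumr.
apply: eq_bigr => -[i' j'] _ /=; rewrite -scalerAr !tcoefZ taft_monoM.
rewrite tcoefZ !tcoef_mono add0n [(1 : 'Z_n) + _]addrC -subr_eq0 -addrA.
have -> : (j' + (1 - j) == 0) = (j' == j - 1).
  by rewrite -[RHS]subr_eq0 opprB.
case: (i' =P i :> nat) => [->|]; last by rewrite /= andbF !mulr0.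
by rewrite /= modn_small ?Zp_cast // mul1n; rewrite mulrCA.
Qed.

Lemma tcoef_mul_mono0 i j l y :
  tcoef i j (y * taft_mono hw 0 l) = tcoef i (j - l) y.
Proof.
rewrite [y]taft_sum_mono mulr_suml !tcoef_sum.
apply: eq_bigr => -[i' j'] _ /=; rewrite -scalerAl !tcoefZ taft_monoM.
by rewrite muln0 scale1r addn0 !tcoef_mono (eq_sym _ (j - l)) subr_eq (eq_sym j).
Qed.

Lemma taft_monoX j k : taft_mono hw 0 j ^+ k = taft_mono hw 0 (j *+ k).
Proof.
elim: k => [|k IHk]; first by rewrite taft_mono00.
by rewrite exprS IHk taft_monoM muln0 scale1r mulrS.
Qed.

Lemma skew_power_coef alpha k i j :
  (k <= i)%N -> (i < n)%N ->
  tcoef i j ((x + alpha *: g) ^+ k) = ((k == i) && (j == 0))%:R.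
Proof.
elim: k i j => [|k IHk] i j le_ki lt_i.
  by rewrite expr0 -taft_mono00 tcoef_mono lt_i eq_sym (eq_sym j).
case: i le_ki lt_i => // i le_ki lt_i.
rewrite exprS mulrDl -scalerAl tcoefD tcoefZ tcoef_xM // tcoef_gM.
rewrite !IHk ?(ltnW lt_i) ?(ltnW le_ki) // eqSS.
by rewrite (ltn_eqF le_ki) !mulr0 addr0.
Qed.

Lemma top_coef i0 j0 y : tcoef i0 j0 y != 0 ->
  exists m j, [/\ (i0 <= m)%N, tcoef m j y != 0 &
                  forall i l, (m < i)%N -> tcoef i l y = 0].
Proof.
move=> nz; have lt_i0 : (i0 < n)%N.
  by rewrite ltnNge; apply: contra nz => /tcoef_ge ->.
pose b0 : taft_data hw := (Ordinal lt_i0, j0).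
pose Q := [pred b : taft_data hw | y b != 0].
have Qb0 : Q b0 by rewrite /= -tcoefE.
case: (arg_maxnP (fun b : taft_data hw => nat_of_ord b.1) Qb0) => b Qb maxb.
exists b.1, b.2; split; first exact: maxb b0 Qb0.
  by rewrite tcoefE.
move=> i l lt_i; have [lt_in|] := ltnP i n; last exact: tcoef_ge.
apply/eqP; apply: contraTT lt_i => nz_il; rewrite -leqNgt.
by apply: (maxb (Ordinal lt_in, l)); rewrite /= -tcoefE.
Qed.

Section LeftCoidealSubalgebra.
Variable N : {vspace taft hw}.
Hypothesis coN : left_coideal_subalgebra N.

Let N1 : 1 \in N. Proof. by have [[]] := coN. Qed.
Let NN : {in N & N, forall u v, u * v \in N}.
Proof. by have [[_ /prodvP]] := coN. Qed.
Let lowN y k l : y \in N -> lower k l y \in N.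
Proof. by have [_ /(coidealP n1)] := coN; apply. Qed.

Lemma expN y k : y \in N -> y ^+ k \in N.
Proof. by move=> yN; elim: k => [|k IHk]; rewrite ?exprS ?NN. Qed.

Lemma mono0_invN j : taft_mono hw 0 j \in N -> taft_mono hw 0 (- j) \in N.
Proof.
(* Inverses are powers because g has finite order. *)
move=> jN; have -> : - j = j *+ n.-1.
  apply/eqP; rewrite eq_sym -addr_eq0 -mulrSr prednK ?(ltnW n1) //.
  by rewrite -mulr_natr pchar_Zp ?mulr0.
by rewrite -taft_monoX expN.
Qed.

(** Lowering by the top x-degree m leaves only the coefficient at x^m g^j. *)
Lemma top_coef_mono m j y : y \in N -> tcoef m j y != 0 ->
  (forall i l, (m < i)%N -> tcoef i l y = 0) -> taft_mono hw 0 j \in N.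
Proof.
move=> yN nz top; have := lowN m j yN.
have -> : lower m j y = tcoef m j y *: taft_mono hw 0 j.
  apply: tcoefP => -[|i] l lt_i; rewrite tcoef_lower tcoefZ tcoef_mono lt_i.
    rewrite add0r add0n qbinomi0 mulr1 (eq_sym j) /= mulrC.
    by have [->|_] := eqVneq l j; rewrite ?mulr0.
  by rewrite top ?mulr0 // addSn ltnS leq_addl.
by move=> H; rewrite -[taft_mono _ _ _](scalerK nz) memvZ.
Qed.

(** If y has top term x^m g^j, then lowering by m - 1 leaves
    a g^(j+1) + b x g^j, where b <> 0 because it is a multiple of the nonzero
    q-integer [m]; and N contains g^(-j). *)
Lemma skew_primitive_mem i j y : y \in N -> (0 < i)%N -> tcoef i j y != 0 ->
  exists alpha, x + alpha *: g \in N.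
Proof.
move=> yN i_gt0 /top_coef [m [{}j [le_im nz top]]].
case: m le_im nz top => [|m] le_im nz top; first by rewrite leqNgt i_gt0 in le_im.
have lt_m : (m.+1 < n)%N by rewrite ltnNge; apply: contra nz => /tcoef_ge ->.
have jN := mono0_invN (top_coef_mono yN nz top).
pose a := tcoef m (j + 1) y; pose b := qbinom w m 1 * tcoef m.+1 j y.
have nz_b : b != 0 by rewrite mulf_neq0 ?(qbinom_neq0 hw) // addn1.
have lowE : lower m (j + 1) y =
    a *: taft_mono hw 0 (j + 1) + b *: taft_mono hw 1 j.
  apply: tcoefP => i' l lt_i'.
  rewrite tcoef_lower tcoefD !tcoefZ !tcoef_mono lt_i' /=.
  case: i' lt_i' => [|[|i']] lt_i' /=.
  - rewrite add0r add0n qbinomi0 mulr1 mulr0 addr0 (eq_sym _ l) mulrC.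
    by have [->|_] := eqVneq l (j + 1); rewrite ?mulr0.
  - rewrite mulr0 add0r addrC (inj_eq (addIr 1)) add1n (eq_sym j) /b.
    by have [->|_] := eqVneq l j; rewrite ?mulr0 ?mul0r ?mul1r ?mulr1.
  - by rewrite top ?mulr0 ?addr0 // !addSn !ltnS leq_addl.
exists (b^-1 * a); have := NN (lowN m (j + 1) yN) jN; rewrite lowE mulrDl.
rewrite -!scalerAl !taft_monoM !muln0 !scale1r !addn0 subrr addrAC subrr add0r.
by move=> /(memvZ b^-1); rewrite scalerDr !scalerA mulVf // scale1r addrC.
Qed.

(** Induction on the x-degree of y in N: whenever y has a term c x^m g^j of top
    degree, g^j is in N, and c z^m g^j cancels that term. *)
Lemma skew_power_span alpha V : x + alpha *: g \in N ->
  (forall k j, (k < n)%N -> taft_mono hw 0 j \in N ->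
     (x + alpha *: g) ^+ k * taft_mono hw 0 j \in V) ->
  (N <= V)%VS.
Proof.
move=> zN zV; apply/subvP => y.
have [m top] : exists m, forall i l, (m <= i)%N -> tcoef i l y = 0.
  by exists n => i l; apply: tcoef_ge.
elim: m y top => [|m IHm] y top yN.
  by rewrite (_ : y = 0) ?mem0v //; apply: tcoefP => i j _; rewrite top ?tcoef0.
pose t j := tcoef m j y *: ((x + alpha *: g) ^+ m * taft_mono hw 0 j).
have tNV j : t j \in N /\ t j \in V.
  rewrite /t; have [->|nz] := eqVneq (tcoef m j y) 0; first by rewrite scale0r !mem0v.
  have lt_m : (m < n)%N by rewrite ltnNge; apply: contra nz => /tcoef_ge ->.
  have jN := top_coef_mono yN nz top.
  by rewrite !memvZ ?zV // NN ?expN.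
have tN : \sum_j t j \in N by apply: memv_suml => j _; have [] := tNV j.
have tV : \sum_j t j \in V by apply: memv_suml => j _; have [] := tNV j.
rewrite -[y](subrK (\sum_j t j)) memvD //; apply: IHm; last exact: memvB.
move=> i l le_mi; have [lt_in|le_ni] := ltnP i n; last by rewrite tcoef_ge.
rewrite tcoefB tcoef_sum.
under eq_bigr do rewrite tcoefZ tcoef_mul_mono0 skew_power_coef //.
have [lt_mi|ge_mi|<-] := ltngtP m i.
- by rewrite top // big1 ?subr0 // => j _; rewrite mulr0.
- by rewrite leqNgt ge_mi in le_mi.
rewrite (bigD1 l) //= subrr eqxx mulr1 big1 ?addr0 ?subrr // => j ne.
by rewrite subr_eq0 eq_sym (negPf ne) mulr0.
Qed.

(** As g^j x = w^j x g^j, the commutator of g^j and x + alpha g is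
    (w^j - 1) x g^j. *)
Lemma skew_commutator alpha j : x + alpha *: g \in N ->
  taft_mono hw 0 j \in N -> j != 0 -> x \in N.
Proof.
move=> zN jN nz_j.
have nz : w ^+ j - 1 != 0.
  rewrite subr_eq0 -(expr0 w) (eq_prim_root_expr hw) mod0n modn_small //.
  by have := ltn_ord j; rewrite {2}Zp_cast.
have : (w ^+ j - 1) *: taft_mono hw 1 j \in N.
  have := memvB (NN jN zN) (NN zN jN); rewrite mulrDl mulrDr -scalerAl -scalerAr.
  rewrite !taft_monoM !muln0 !muln1 !scale1r !addn0 !add0n add0r addr0 (addrC j).
  by rewrite opprD addrACA subrr addr0 scalerBl scale1r.
move=> /(memvZ (w ^+ j - 1)^-1); rewrite scalerK // => xjN.
have := NN xjN (mono0_invN jN).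
by rewrite taft_monoM muln0 scale1r addn0 subrr.
Qed.

(** A nonzero y in N killed by pi has a term of positive x-degree, which puts some
    z = x + alpha g in N.  If x is not in N, then alpha <> 0 and no g^j <> 1 is in N,
    so y is a combination of the z^k with k < n; but pi(z^k) = alpha^k g^k, and
    these are linearly independent. *)
Lemma proj_inj_notin_x : x \notin N -> {in N &, injective (taft_proj hw)}.
Proof.
move=> xN; suff ker0 y : y \in N -> taft_proj hw y = 0 -> y = 0.
  move=> u v uN vN eq_uv; apply/eqP; rewrite -subr_eq0; apply/eqP/ker0.
    exact: memvB.
  by rewrite linearB /= eq_uv subrr.
move=> yN piy0; apply/eqP/negPn/negP => nz_y.
have coef0 l : tcoef 0 l y = 0 by rewrite -(taft_projE n1) piy0 ffunE.
have [i [j nz]] := tcoef_neq0 nz_y.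
have i_gt0 : (0 < i)%N by rewrite lt0n; apply: contra nz => /eqP ->; rewrite coef0.
have [alpha zN] := skew_primitive_mem yN i_gt0 nz.
have nz_alpha : alpha != 0.
  by apply: contraNneq xN => a0; rewrite a0 scale0r addr0 in zN.
have natZ_inj (k m : 'I_n) : (k%:R == m%:R :> 'Z_n) = (k == m).
  rewrite -val_eqE /= !val_Zp_nat //.
  by rewrite !modn_small ?ltn_ord.
pose z := x + alpha *: g; pose V := (\sum_(k < n) <[z ^+ k]>)%VS.
have /subvP/(_ _ yN)/memv_sumP : (N <= V)%VS.
  apply: (skew_power_span zN) => k l lt_k lN.
  have -> : l = 0 by apply/eqP; apply: contraNT xN; exact: skew_commutator zN lN.
  by rewrite taft_mono00 mulr1 memvE (sumv_sup (Ordinal lt_k)).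
case=> v vV ey.
have cE (k : 'I_n) : v k = tcoef k 0 (v k) *: z ^+ k.
  have /vlineP [a ->] := vV k isT.
  by rewrite tcoefZ skew_power_coef // !eqxx mulr1.
have proj_z k : taft_proj hw (z ^+ k) = alpha ^+ k *: grpalg_of K (k%:R : 'Z_n).
  have projz : taft_proj hw z = alpha *: grpalg_of K (1%R : 'Z_n).
    have [X0 G1 GX] := taft_proj_rel w n1.
    rewrite linearD linearZ /= /taft_proj (taft_map_x hw _ X0) ?(taft_map_g hw _ X0) //.
    by rewrite add0r.
  rewrite -grpalg_of_Zp -exprZn -projz.
  by elim: k => [|k IHk]; rewrite ?(taft_proj1 hw n1) // !exprS (taft_projM n1) IHk.
case/negP: nz_y; apply/eqP; rewrite ey big1 // => m _.
suff c0 : tcoef m 0 (v m) = 0 by rewrite cE c0 scale0r.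
have := congr1 (fun u : grpalg K 'Z_n => u m%:R) piy0.
rewrite ey linear_sum sum_ffunE (bigD1 m) //= big1 ?addr0 => [|k ne].
  rewrite {1}cE linearZ /= proj_z !ffunE eqxx /GRing.scale /= mulr1 => /eqP.
  by rewrite mulf_eq0 expf_eq0 (negPf nz_alpha) andbF orbF => /eqP.
rewrite cE linearZ /= proj_z !ffunE natZ_inj (negPf ne) /GRing.scale /=.
by rewrite !mulr0.
Qed.

Lemma coideal_dx_mem d : x \in coideal_dx hw d /\ g ^+ d \in coideal_dx hw d.
Proof.
by split; apply: seqv_sub_adjoin; rewrite !inE eqxx ?orbT.
Qed.

(** N is spanned by the x^k g^j with g^j in N, by [skew_power_span] at alpha = 0, and
    the g^j in N are the powers of g^d for the least positive exponent d. *)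
Lemma mem_x_coideal_dx : x \in N ->
  exists d, (d %| n)%N /\ N = coideal_dx hw d.
Proof.
move=> xN.
have ex_d : exists d, (0 < d)%N && (g ^+ d \in N).
  by exists n; rewrite taft_gn // N1 (ltnW n1).
case: (ex_minnP ex_d) => d /andP [d_gt0 dN] min_d.
have dvd_d k : g ^+ k \in N -> (d %| k)%N.
  move=> kN; rewrite /dvdn; apply: contraTT (ltn_pmod k d_gt0); rewrite -lt0n -leqNgt => r_gt0.
  apply: min_d; rewrite r_gt0 /=.
  (* The exponent n.-1 turns (g^d)^(k %/ d) into its inverse, since g^n = 1. *)
  have -> : g ^+ (k %% d)%N = g ^+ k * (g ^+ d) ^+ (k %/ d * n.-1).
    rewrite -exprM -exprD {2}(divn_eq k d) addnAC (mulnC _ n.-1) mulnCA (mulnC d).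
    have {1}-> : (k %/ d * d + n.-1 * (k %/ d * d) = n * (k %/ d * d))%N.
      by rewrite -mulSn prednK ?(ltnW n1).
    by rewrite exprD exprM taft_gn // expr1n mul1r.
  exact: NN kN (expN _ dN).
exists d; split; first by apply: dvd_d; rewrite taft_gn // N1.
have [xD gD] := coideal_dx_mem d.
have DD : {in coideal_dx hw d &, forall u v, u * v \in coideal_dx hw d}.
  by move=> u v uD vD; have := memv_mul uD vD; rewrite agenvM.
have DX u k : u \in coideal_dx hw d -> u ^+ k \in coideal_dx hw d.
  move=> uD; elim: k => [|k IHk]; last by rewrite exprS DD.
  by rewrite memvE sub1_agenv.
apply: subv_anti; apply/andP; split.
  apply: (@skew_power_span 0); rewrite scale0r addr0 // => k j _ jN.
  rewrite DD ?DX // -[j]natr_Zp -taft_gX.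
  have /dvdnP [q ->] : (d %| j)%N by apply: dvd_d; rewrite taft_gX natr_Zp.
  by rewrite mulnC exprM DX.
apply: agenv_sub_modl; first by rewrite -memvE.
apply: subv_trans (_ : N * N <= N)%VS; last by have [[]] := coN.
apply: prodvSl; rewrite subv_add -memvE N1; apply/span_subvP => u.
by rewrite !inE => /orP [] /eqP ->.
Qed.

(** The ideal I = N :&: ker pi has no complement.  Write 1 = a + b with a in I and b
    in a complement; then x b = 0 and x = x a, although x a has
    x-degrees at least 2. *)
Lemma x_not_semisimple : x \in N -> ~ semisimple N.
Proof.
move=> xN ssN; pose I := (N :&: lker (taft_proj hw))%VS.
have Ix : x \in I.
  have [X0 _ _] := taft_proj_rel w n1.
  by rewrite memv_cap xN memv_ker /taft_proj (taft_map_x hw _ X0) eqxx.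
have NI u v : u \in N -> v \in I -> u * v \in I.
  rewrite !memv_cap !memv_ker => uN /andP [vN /eqP v0].
  by rewrite NN //= (taft_projM n1) v0 mulr0.
have [J [[subJN /prodvP NJ] IJ IJ0]] : exists J,
    [/\ left_ideal N J, (I + J)%VS = N & (I :&: J)%VS = 0%VS].
  by apply: ssN; split; [exact: capvSl | apply/prodvP].
have /memv_addP [a aI [b bJ e1]] : 1 \in (I + J)%VS by rewrite IJ.
have xb0 : x * b = 0.
  apply/eqP; rewrite -memv0 -IJ0 memv_cap NJ // andbT.
  have -> : b = 1 - a by rewrite e1 addrC addKr.
  by rewrite mulrBr mulr1 memvB // NI.
have : tcoef 1 0 x = 1 :> K by rewrite tcoef_mono n1.
have -> : x = x * a by rewrite -[LHS]mulr1 e1 mulrDr xb0 addr0.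
rewrite tcoef_xM // -(taft_projE n1).
have: a \in lker (taft_proj hw) by move: aI; rewrite memv_cap => /andP [].
rewrite memv_ker => /eqP ->; rewrite ffunE => /eqP.
by rewrite eq_sym oner_eq0.
Qed.

End LeftCoidealSubalgebra.

(** The preimage under Delta of the subalgebra H (x) N_(d,x) is a subalgebra, so it
    is enough that it contains the generators. *)
Lemma coideal_dx_subalgebra d : left_coideal_subalgebra (coideal_dx hw d).
Proof.
split; first by split; [rewrite memvE sub1_agenv | rewrite agenvM].
have [xD gD] := coideal_dx_mem d; set D := coideal_dx hw d in xD gD *.
have D1 : 1 \in D by rewrite memvE sub1_agenv.
have DD : (D * D <= D)%VS by rewrite agenvM.
have /ahom_inP [M one] := taft_comul_ahom hw n1.
have TT := tensv_closed (taft_data hw) DD.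
suff: (D <= taft_comul hw @^-1: tensv fullv D)%VS.
  by move=> /subvP sub; apply/subvP => _ /memv_imgP [y /sub yD ->]; rewrite memv_preim.
have T1 : 1 \in (taft_comul hw @^-1: tensv fullv D)%VS.
  by rewrite -memv_preim one -tens11 memv_tens ?memvf.
apply: agenv_sub_modl; first by rewrite -memvE.
have sub : (1 + <<[:: (g ^+ d)%R; x]>> <= taft_comul hw @^-1: tensv fullv D)%VS.
  rewrite subv_add -memvE T1; apply/span_subvP => u; rewrite !inE => /orP [] /eqP ->.
    rewrite -memv_preim.
    have -> : taft_comul hw (g ^+ d) = tens (g ^+ d) (g ^+ d).
      rewrite -tensX -(taft_comul_g hw n1); elim: (d) => [|k IHk]; first exact: one.
      by rewrite !exprS M ?memvf // IHk.
    by rewrite memv_tens ?memvf.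
  by rewrite -memv_preim taft_comul_x // memvD // memv_tens ?memvf.
apply/prodvP => u v /(subvP sub); rewrite -!memv_preim => uT vT.
by rewrite M ?memvf //; apply: (prodvP TT).
Qed.

Lemma semisimple_proj_inj N : left_coideal_subalgebra N -> semisimple N ->
  {in N &, injective (taft_proj hw)}.
Proof.
move=> coN ssN; apply: proj_inj_notin_x => //; apply/negP => xN.
exact: x_not_semisimple coN xN ssN.
Qed.

(** * Semisimple subalgebras and projections *)

Lemma counit_proj y : taft_counit hw y = \sum_j taft_proj hw y j.
Proof. by rewrite (taft_counitE n1); apply: eq_bigr => j _; rewrite taft_projE. Qed.

(** If x were in N_P, then x P = eps(x) P = 0 would force eps(P) = 0. *)
Lemma proj_coideal_semisimple P :
  right_grouplike_projection P -> semisimple (proj_coideal P).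
Proof.
move=> gP; have coP := proj_coideal_subalgebra n1 P.
apply: (proj_inj_semisimple n1) => //; apply: proj_inj_notin_x => //; apply/negP => xP.
have [xP0 _] := proj_coideal_act n1 xP.
have cx : taft_counit hw x = 0.
  rewrite (taft_counitE n1) big1 // => j _; rewrite tcoef_mono andbF //.
rewrite cx scale0r in xP0.
have := grouplike_projection_counit n1 gP; rewrite (taft_counitE n1) big1 => [/eqP|j _].
  by rewrite eq_sym oner_eq0.
by rewrite -tcoef_xM // xP0 tcoef0.
Qed.

(** The component P of 1 in a complement J of the augmentation ideal I: for y in N,
    (y - eps(y)) P is in I, because N is commutative and I is an ideal,
    and in J, hence is zero. *)
Lemma semisimple_integral N : left_coideal_subalgebra N -> semisimple N ->
  exists P, [/\ P \in N, taft_counit hw P = 1 &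
    forall y, y \in N ->
      y * P = taft_counit hw y *: P /\ P * y = taft_counit hw y *: P].
Proof.
move=> coN ssN; have inj := semisimple_proj_inj coN ssN.
have [[N1 /prodvP NN] _] := coN.
have comm u v : u \in N -> v \in N -> u * v = v * u.
  move=> uN vN; apply: inj; rewrite ?NN // !(taft_projM n1).
  exact: grpalg_Zp_comm.
pose I := (N :&: lker (taft_counit hw))%VS.
have NI : left_ideal N I.
  split; first exact: capvSl.
  apply/prodvP => u v uN; rewrite !memv_cap !memv_ker => /andP [vN /eqP v0].
  by rewrite NN //= (taft_counitM n1) v0 mulr0.
have [J [[subJN /prodvP NJ] IJ IJ0]] := ssN I NI.
have /memv_addP [a aI [b bJ e1]] : 1 \in (I + J)%VS by rewrite IJ.
have bN : b \in N := subvP subJN _ bJ.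
have actb y : y \in N -> y * b = taft_counit hw y *: b.
  move=> yN; pose y0 : taft hw := y - taft_counit hw y *: (1 : taft hw).
  have y0I : y0 \in I.
    rewrite memv_cap memvB ?memvZ // memv_ker linearB linearZ /= (taft_counit1 hw n1).
    by rewrite /GRing.scale /= mulr1 subrr.
  have y0N : y0 \in N by move: y0I; rewrite memv_cap => /andP [].
  apply/eqP; rewrite -subr_eq0 -[X in _ - _ *: X]mul1r scalerAl -mulrBl -/y0.
  rewrite -memv0 -IJ0 memv_cap NJ // andbT comm //.
  by have [_ /prodvP NI'] := NI; apply: NI'.
exists b; split=> // [|y yN]; last by rewrite actb // -comm // actb.
have: a \in lker (taft_counit hw) by move: aI; rewrite memv_cap => /andP [].
rewrite memv_ker => /eqP a0.
by have := taft_counit1 hw n1; rewrite e1 linearD /= a0 add0r.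
Qed.

(** Surjectivity of P |-> N_P.  The integral P of N gives N <= N_P; for
    the converse, the images of both algebras under pi are group algebras K G1 and
    K G2, and h in G2 satisfies h pi(P) = pi(P) with pi(P) a nonzero element of
    K G1, so h is in G1. *)
Lemma semisimple_proj_coideal N : left_coideal_subalgebra N -> semisimple N ->
  exists P, right_grouplike_projection P /\ proj_coideal P = N.
Proof.
move=> coN ssN; have [P [PN epsP actP]] := semisimple_integral coN ssN.
have subN := sub_proj_coideal n1 coN actP.
have nzP : P != 0.
  by apply/eqP => P0; move/eqP: epsP; rewrite P0 linear0 eq_sym oner_eq0.
have gP : right_grouplike_projection P.
  apply/grouplike_projectionP; split=> //; last exact: (subvP subN).
  by have [-> _] := actP P PN; rewrite epsP scale1r.
exists P; split=> //; apply: subv_anti; rewrite subN andbT.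
have coNP := proj_coideal_subalgebra n1 P.
have ssNP := proj_coideal_semisimple gP.
have [G1 imN] := proj_image n1 coN; have [G2 imNP] := proj_image n1 coNP.
have sub21 : {subset G2 <= G1}.
  move=> h G2h; have : grpalg_of K h \in (taft_proj hw @: proj_coideal P)%VS.
    by rewrite imNP memv_span // map_f // mem_enum.
  case/memv_imgP=> u uNP eh.
  have eps_u : taft_counit hw u = 1.
    rewrite counit_proj -eh (bigD1 h) //= ffunE eqxx big1 ?addr0 // => k ne.
    by rewrite ffunE eq_sym (negPf ne).
  have [uP _] := proj_coideal_act n1 uNP; rewrite eps_u scale1r in uP.
  have hP : grpalg_of K h * taft_proj hw P = taft_proj hw P by rewrite eh -taft_projM // uP.
  have [k nz_k] : exists k : 'Z_n, taft_proj hw P k != 0.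
    apply/existsP; apply: contraT; rewrite negb_exists => /forallP P0.
    have := epsP; rewrite counit_proj big1 => [/eqP|k _].
      by rewrite eq_sym oner_eq0.
    by apply/eqP/negPn/P0.
  have PG1 : taft_proj hw P \in subgrpalg K G1 by rewrite -imN memv_img.
  have G1k := subgrpalg_coef PG1 nz_k.
  have := subgrpalg_coef PG1 (h := (h * k)%g); rewrite -{1}hP grpalg_of_mul_coef.
  by move=> /(_ nz_k); rewrite groupMr.
apply/subvP => y yNP.
have : taft_proj hw y \in (taft_proj hw @: N)%VS.
  have : taft_proj hw y \in subgrpalg K G2 by rewrite -imNP memv_img.
  rewrite imN; apply: subvP; apply/span_subvP => _ /mapP [h G2h ->].
  by rewrite memv_span // map_f // mem_enum sub21 // -mem_enum.
case/memv_imgP=> u uN eq_yu.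
by rewrite (semisimple_proj_inj coNP ssNP yNP (subvP subN _ uN) eq_yu).
Qed.

End Classification.

Theorem proposition4p4 (K : fieldType) (n : nat) (w : K)
    (hn : (2 <= n)%N) (hw : n.-primitive_root w) :
  [/\ (* semisimple left coideal subalgebras are isomorphic to some K G', G' <= G,
         through N -> H -> K G *)
      (forall N : {vspace taft hw},
         left_coideal_subalgebra N -> semisimple N ->
         exists G' : {group 'Z_n},
           {in N &, injective (taft_proj hw)} /\
           (taft_proj hw @: N)%VS = subgrpalg K G'),
      (* P |-> N_P is a bijection from right group-like projections to semisimple
         left coideal subalgebras *)
      [/\ (forall P : taft hw, right_grouplike_projection P ->
             left_coideal_subalgebra (proj_coideal P) /\
             semisimple (proj_coideal P)),
          (forall P Q : taft hw,
             right_grouplike_projection P -> right_grouplike_projection Q ->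
             proj_coideal P = proj_coideal Q -> P = Q)
        & (forall N : {vspace taft hw},
             left_coideal_subalgebra N -> semisimple N ->
             exists P : taft hw,
               right_grouplike_projection P /\ proj_coideal P = N)],
      (* the N_{d,x} are left coideal subalgebras *)
      (forall d : nat, (d %| n)%N -> left_coideal_subalgebra (coideal_dx hw d))
    & (* non-semisimple left coideal subalgebras are among the N_{d,x} *)
      (forall N : {vspace taft hw},
         left_coideal_subalgebra N -> ~ semisimple N ->
         exists d : nat, (d %| n)%N /\ N = coideal_dx hw d)].
Proof.
split.
- move=> N coN ssN; have [G' imN] := proj_image hn coN.
  by exists G'; split; first exact: semisimple_proj_inj.
- split; [|exact: proj_coideal_inj|exact: semisimple_proj_coideal].
  by move=> P gP; split; [exact: proj_coideal_subalgebra|exact: proj_coideal_semisimple].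
- by move=> d _; apply: coideal_dx_subalgebra.
- move=> N coN nssN; apply: (mem_x_coideal_dx hn coN).
  apply: contraT => xN; case: nssN.
  exact/(proj_inj_semisimple hn coN)/proj_inj_notin_x.
Qed.
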